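(* Let $E/\mathbb{Q}$ be an elliptic curve without complex multiplication that has abelian entanglements, and let $m=\prod_{\ell\mid m_E}\ell$ be the square-free part of $m_E$. Let $\Phi_m=\big(\prod_{\ell\mid m}G(\ell)\big)/G(m)$ with quotient map $\psi_m$. For a character $\tilde\chi$ of $\Phi_m$ let $\chi=\tilde\chi\circ\psi_m$ and define $E_{\chi,\ell}=1$ if $\chi$ is trivial on the factor $G(\ell)$, and $E_{\chi,\ell}=\frac{-1}{[\mathbb{Q}(E[\ell]):\mathbb{Q}]-1}$ otherwise. Let $\delta_\ell=1-\frac{1}{[\mathbb{Q}(E[\ell]):\mathbb{Q}]}$ and $C_E=\sum_{n\geq1}\frac{\mu(n)}{[\mathbb{Q}(E[n]):\mathbb{Q}]}$. Then $C_E=\mathfrak{C}_E\prod_\ell\delta_\ell$, where $$\mathfrak{C}_E=1+\sum_{\tilde\chi\in\widehat{\Phi}_m\setminus\{1\}}\prod_{\ell\mid m}E_{\chi,\ell}.$$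
   Context: $\mu$ is the Möbius function; products over $\ell$ run over primes. $G(n)\leqslant\mathrm{GL}_2(\mathbb{Z}/n\mathbb{Z})$ is the image of the mod-$n$ Galois representation, viewed for square-free $n$ as a subgroup of $\prod_{\ell\mid n}G(\ell)$; it is normal with abelian quotient since $E$ has abelian entanglements. $\widehat{\Phi}_m$ is the character group of $\Phi_m$. Definitions: let $G\leqslant\mathrm{GL}_2(\widehat{\mathbb{Z}})$ be the adelic image of $E$ and $G_{n^\infty}$ its image in $\prod_{\ell\mid n}\mathrm{GL}_2(\mathbb{Z}_\ell)$; $n$ is stable if $G_{n^\infty}$ is the full preimage of $G(n)$, split if $G=G_{n^\infty}\times\prod_{\ell\nmid n}\mathrm{GL}_2(\mathbb{Z}_\ell)$; $m_E$ is the smallest split and stable positive integer. A subgroup $H\leqslant H_1\times\dots\times H_k$ surjecting onto each factor has abelian entanglements if for every partition $\{A,B\}$ of $\{1,\dots,k\}$ into nonempty sets the Goursat quotient $H_A/\{x\in H_A:(x,1)\in H\}$ is abelian ($H_A$ = image of $H$ in $\prod_{i\in A}H_i$). $E$ has abelian entanglements if $G(m_E)\leqslant\prod_{\ell^\alpha\|m_E}G(\ell^\alpha)$ has abelian entanglements. *)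

(* Defs.v *)
From HB Require Import structures.
From mathcomp Require Import all_boot all_order all_algebra all_fingroup.
From mathcomp Require Import all_solvable all_field all_character.
From mathcomp Require Import boolp reals topology normedtype sequences.

Set Implicit Arguments.
Unset Strict Implicit.
Unset Printing Implicit Defensive.

Import Order.TTheory GRing.Theory Num.Theory.
Local Open Scope ring_scope.

Definition nonsingular (a b : rat) : bool := 4 * a ^+ 3 + 27 * b ^+ 2 != 0.

Definition point := option (algC * algC).

Definition on_curve (a b : rat) (P : point) : bool :=
  match P with
  | None => true
  | Some (x, y) => y ^+ 2 == x ^+ 3 + ratr a * x + ratr b
  end.

Definition pneg (P : point) : point :=
  match P with None => None | Some (x, y) => Some (x, - y) end.

Definition padd (a : rat) (P Q : point) : point :=
  match P, Q with
  | None, _ => Q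
  | _, None => P
  | Some (x1, y1), Some (x2, y2) =>
    if x1 == x2 then
      if y1 == - y2 then None
      else
        let l := (3 * x1 ^+ 2 + ratr a) / (2 * y1) in
        let x3 := l ^+ 2 - x1 - x2 in
        Some (x3, l * (x1 - x3) - y1)
    else
      let l := (y2 - y1) / (x2 - x1) in
      let x3 := l ^+ 2 - x1 - x2 in
      Some (x3, l * (x1 - x3) - y1)
  end.

Fixpoint pmuln (a : rat) (k : nat) (P : point) : point :=
  match k with 0%N => None | k'.+1 => padd a P (pmuln a k' P) end.

Definition pmulz (a : rat) (k : int) (P : point) : point :=
  match k with Posz n => pmuln a n P | Negz n => pneg (pmuln a n.+1 P) end.

Definition tors (a b : rat) (n : nat) (P : point) : bool :=
  on_curve a b P && (pmuln a n P == None).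

Definition gact (s : algC -> algC) (P : point) : point :=
  match P with None => None | Some (x, y) => Some (s x, s y) end.

(* evaluation of a bivariate polynomial (outer variable Y, inner X) *)
Definition eval2 (p : {poly {poly algC}}) (x y : algC) : algC := (p.[y%:P]).[x].

(* an endomorphism of E over Qbar: a group endomorphism of E(Qbar) given,
   away from finitely many points, by rational functions *)
Definition is_endo (a b : rat) (phi : point -> point) : Prop :=
  [/\ forall P, on_curve a b P -> on_curve a b (phi P),
      forall P Q, on_curve a b P -> on_curve a b Q ->
        phi (padd a P Q) = padd a (phi P) (phi Q)
    & exists (p1 q1 p2 q2 : {poly {poly algC}}) (s : seq (algC * algC)),
        forall x y, on_curve a b (Some (x, y)) -> (x, y) \notin s ->
          [/\ eval2 q1 x y != 0, eval2 q2 x y != 0 &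
              phi (Some (x, y)) =
                Some (eval2 p1 x y / eval2 q1 x y, eval2 p2 x y / eval2 q2 x y)]].

Definition has_CM (a b : rat) : Prop :=
  exists phi, is_endo a b phi /\
    ~ (exists k : int, forall P, on_curve a b P -> phi P = pmulz a k P).

Definition subfield_pred (K : algC -> Prop) : Prop :=
  [/\ K 1, forall x y, K x -> K y -> K (x - y),
      forall x y, K x -> K y -> K (x * y) & forall x, K x -> K x^-1].

Definition QE (a b : rat) (n : nat) (z : algC) : Prop :=
  forall K, subfield_pred K ->
    (forall x y, tors a b n (Some (x, y)) -> K x /\ K y) -> K z.

Definition Q_linindep (s : seq algC) : Prop :=
  forall c : seq rat, size c = size s ->
    \sum_(i < size s) ratr c`_i * s`_i = 0 -> forall i, c`_i = 0.

Definition field_deg (K : algC -> Prop) (d : nat) : Prop :=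
  (exists s : seq algC, [/\ size s = d, forall z, z \in s -> K z & Q_linindep s])
  /\ forall s : seq algC, size s = d.+1 -> (forall z, z \in s -> K z) ->
       ~ Q_linindep s.

(* #|G(N)| = k : exactly k distinct actions of Gal(Qbar/Q) on E[N] *)
Definition gal_card (a b : rat) (N k : nat) : Prop :=
  exists s : seq {rmorphism algC -> algC},
    [/\ size s = k,
        forall i j, (i < k)%N -> (j < k)%N -> i <> j ->
          exists P, tors a b N P /\
            gact (nth idfun (map (fun f : {rmorphism algC -> algC} => fun x => f x) s) i) P <>
            gact (nth idfun (map (fun f : {rmorphism algC -> algC} => fun x => f x) s) j) P
      & forall sg : {rmorphism algC -> algC}, exists i, (i < k)%N /\
          forall P, tors a b N P -> gact sg P = gact (nth idfun (map (fun f : {rmorphism algC -> algC} => fun x => f x) s) i) P].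

Definition gl2_card (N : nat) : nat :=
  \prod_(p <- primes N) (p ^ (4 * (logn p N).-1) * (p ^ 2 - 1) * (p ^ 2 - p))%N.

Definition primes_dvd (N n : nat) : Prop := forall p, prime p -> (p %| N)%N -> (p %| n)%N.

(* n stable: G_{n^oo} is the full preimage of G(n), i.e. at every finite
   level N with n | N and sqf_rad N | n, G(N) is the full preimage of G(n) *)
Definition stable (a b : rat) (n : nat) : Prop :=
  forall N k1 k2, (n %| N)%N -> primes_dvd N n ->
    gal_card a b N k1 -> gal_card a b n k2 ->
    (k1 * gl2_card n = k2 * gl2_card N)%N.

(* n split: G = G_{n^oo} x prod_{l not| n} GL_2(Z_l), checked at every finite
   level N1 * N2 with sqf_rad N1 | n and N2 coprime to n *)
Definition split (a b : rat) (n : nat) : Prop :=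
  forall N1 N2 k k1, (0 < N1)%N -> (0 < N2)%N -> primes_dvd N1 n -> coprime N2 n ->
    gal_card a b (N1 * N2) k -> gal_card a b N1 k1 ->
    k = (k1 * gl2_card N2)%N.

Definition is_mE (a b : rat) (mE : nat) : Prop :=
  [/\ (0 < mE)%N, split a b mE, stable a b mE &
      forall k, (0 < k)%N -> split a b k -> stable a b k -> (mE <= k)%N].

Definition ppart (mE : nat) (A : pred nat) : nat :=
  \prod_(p <- primes mE | A p) (p ^ logn p mE)%N.

(* For each partition {A,B} of the primes of mE into nonempty sets, the
   Goursat quotient H_A / {x in H_A : (x,1) in H} is abelian, where
   H = G(mE), H_A = image of H acting on E[d_A] (d_A = prod_{l in A} l^alpha);
   i.e. for all s, t in H there is r in H acting trivially on E[d_B] with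
   st = ts r on E[d_A]. *)
Definition abelian_entanglements (a b : rat) (mE : nat) : Prop :=
  forall A : pred nat,
    has A (primes mE) -> has (predC A) (primes mE) ->
    forall s t : {rmorphism algC -> algC},
      exists r : {rmorphism algC -> algC},
        (forall P, tors a b (ppart mE (predC A)) P -> gact r P = P) /\
        (forall P, tors a b (ppart mE A) P ->
           gact s (gact t P) = gact t (gact s (gact r P))).

Definition sqf_rad (n : nat) : nat := \prod_(p <- primes n) p.

Definition tors_basis (a b : rat) (m : nat) (P Q : point) : Prop :=
  [/\ tors a b m P, tors a b m Q &
      forall R, tors a b m R ->
        exists! ij : nat * nat, [/\ (ij.1 < m)%N, (ij.2 < m)%N &
          R = padd a (pmuln a ij.1 P) (pmuln a ij.2 Q)]].

(* the matrix u represents s on E[l] (l | m) w.r.t. the basis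
   ((m/l) P, (m/l) Q) of E[l] (entries reduced mod l) *)
Definition galmat_at (a : rat) (m l : nat) (P Q : point)
    (s : {rmorphism algC -> algC}) (u : 'M['Z_m]_2) : Prop :=
  let P' := pmuln a (m %/ l) P in
  let Q' := pmuln a (m %/ l) Q in
  gact s P' = padd a (pmuln a (u 0 0) P') (pmuln a (u 1 0) Q') /\
  gact s Q' = padd a (pmuln a (u 0 1) P') (pmuln a (u 1 1) Q').
Arguments galmat_at : clear implicits.

Definition Gm_set (a : rat) (m : nat) (P Q : point) : {set {'GL_2['Z_m]}} :=
  [set u : {'GL_2['Z_m]} | `[< exists s, galmat_at a m m P Q s (GLval u) >]].

(* prod_{l | m} G(l), embedded in GL_2(Z/m) via CRT *)
Definition Gprod_set (a : rat) (m : nat) (P Q : point) : {set {'GL_2['Z_m]}} :=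
  [set u : {'GL_2['Z_m]} | `[< forall l, prime l -> (l %| m)%N ->
                                exists s, galmat_at a m l P Q s (GLval u) >]].

(* the factor G(l) of prod_{l' | m} G(l'): elements trivial mod every other l' *)
Definition Gfactor_set (a : rat) (m l : nat) (P Q : point) : {set {'GL_2['Z_m]}} :=
  [set u in Gprod_set a m P Q | `[< forall l', prime l' -> (l' %| m)%N -> l' <> l ->
       forall i j : 'I_2, ((GLval u i j : nat) = (i == j : nat) %[mod l'])%N >]].

Definition Gm (a : rat) (m : nat) (P Q : point) := <<Gm_set a m P Q>>%G.
Definition Gprod (a : rat) (m : nat) (P Q : point) := <<Gprod_set a m P Q>>%G.

Definition Phi (a : rat) (m : nat) (P Q : point) :=
  (Gprod a m P Q / Gm a m P Q)%G.

Definition Echi (a : rat) (m l : nat) (P Q : point) (degl : nat)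
    (i : Iirr (Phi a m P Q)) : rat :=
  if Gfactor_set a m l P Q \subset cfker ('chi_i %% Gm a m P Q)%CF then 1
  else - 1 / ((degl%:R : rat) - 1).
Arguments Echi : clear implicits.

(* frak C_E (for m = 1, Phi_m is trivial and frak C_E = 1) *)
Definition frakC (a : rat) (m : nat) (P Q : point) (deg : nat -> nat) : rat :=
  if (m <= 1)%N then 1 else
  1 + \sum_(i : Iirr (Phi a m P Q) | (i != 0) && ('chi_i \is a linear_char))
        \prod_(l <- primes m) Echi a m l P Q (deg l) i.

Definition moebius (n : nat) : int :=
  if (0 < n)%N && all (fun p => logn p n == 1)%N (primes n)
  then (-1) ^+ size (primes n) else 0.

(* Main.v *)
Require Import Defs.
From HB Require Import structures.
From mathcomp Require Import all_boot all_order all_algebra all_fingroup.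
From mathcomp Require Import all_solvable all_field all_character.
From mathcomp Require Import boolp reals topology normedtype sequences.
From mathcomp Require Import ring zify.
Import Order.TTheory GRing.Theory Num.Theory numFieldNormedType.Exports.
Set Implicit Arguments.
Unset Strict Implicit.
Unset Printing Implicit Defensive.
Local Open Scope ring_scope.

(* Summing mu over the divisors of m and expanding the indicator function of
   G(m) in the characters of the abelian group Phi_m gives
     sum_(n | m) mu(n)/|G(n)| =
       sum_chi prod_(l | m) ([chi trivial on G(l)] - 1/|G(l)|),
   and each factor on the right is delta_l E_(chi,l). This is proved one divisor
   at a time: 1/|G(n)|, the inverse of the index in G(m) of the subgroup of
   elements that are trivial mod n, is the sum over chi of
     prod_(l | n) 1/|G(l)| * prod_(l | m/n) [chi trivial on G(l)],
   by counting the characters of Phi_m that are trivial on a subgroup. The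
   entanglement hypothesis is used only for the partitions {l}, {l' <> l}, where
   it puts the commutator subgroup of each factor G(l) inside G(m). As m_E is
   split, the remaining primes contribute an absolutely convergent Euler
   product. *)

(** * The group law of the curve *)

(** The group $\prod_{\ell\mid m}G(\ell)$ is kept inside the single group
    $\mathrm{GL}_2(\mathbb{Z}/m)$: the projection to $G(\ell)$ becomes the endomorphism $u\mapsto
    1+e_\ell(u-1)$, with $e_\ell$ the Chinese remainder idempotent, and the character count only
    uses that these endomorphisms are idempotent, orthogonal and multiply to the identity map. The
    link between [deg n] and group orders has three parts: a degree counts the embeddings of
    $\mathbb{Q}(E[n])$ into $\overline{\mathbb{Q}}$; two automorphisms agree on that field exactly
    when they act alike on $E[n]$; and for $n\mid m$ the actions on $E[n]$ correspond to the cosets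
    in $G(m)$ of the elements that are $1$ mod $n$. Matrices presuppose that
    $E(\overline{\mathbb{Q}})$ is an abelian group, so associativity of the chord law has to come
    before everything else. Convergence rests on the bound $\deg n\geq n^2/m_E^2$ for square-free
    $n$, which comes from $|\mathrm{GL}_2(\mathbb{F}_\ell)|\geq\ell^2$. *)

Section Chord.
Variables (F : fieldType) (A B : F).

(* The line Y = l X + n meets Y^2 = X^3 + A X + B exactly in the three points,
   with multiplicity: the last three equations compare the coefficients of
   X^3 + A X + B - (l X + n)^2 and (X - x1)(X - x2)(X - x3). *)
Definition chord x1 y1 x2 y2 x3 y3 (l n : F) : Prop :=
  [/\ y1 = l * x1 + n, y2 = l * x2 + n & y3 = l * x3 + n] /\
  [/\ l ^+ 2 = x1 + x2 + x3,
      A - 2 * l * n = x1 * x2 + x1 * x3 + x2 * x3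
    & n ^+ 2 - B = x1 * x2 * x3].

Lemma chord_swap x1 y1 x2 y2 x3 y3 l n :
  chord x1 y1 x2 y2 x3 y3 l n -> chord x2 y2 x1 y1 x3 y3 l n.
Proof. by rewrite /chord => -[[-> -> ->] [-> -> ->]]; split=> //; split=> //; ring. Qed.

Lemma chord_rot x1 y1 x2 y2 x3 y3 l n :
  chord x1 y1 x2 y2 x3 y3 l n -> chord x2 y2 x3 y3 x1 y1 l n.
Proof. by rewrite /chord => -[[-> -> ->] [-> -> ->]]; split=> //; split=> //; ring. Qed.

Lemma chord_opp x1 y1 x2 y2 x3 y3 l n :
  chord x1 y1 x2 y2 x3 y3 l n ->
  chord x1 (- y1) x2 (- y2) x3 (- y3) (- l) (- n).
Proof.
case=> -[-> -> ->] [e1 e2 e3]; split; first by split; ring.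
by split; [rewrite -e1 | rewrite -e2 | rewrite -e3]; ring.
Qed.

Lemma chord_curve x1 y1 x2 y2 x3 y3 l n :
  chord x1 y1 x2 y2 x3 y3 l n -> y1 ^+ 2 = x1 ^+ 3 + A * x1 + B.
Proof.
case=> -[-> _ _] [e1 e2 e3].
apply/eqP; rewrite -subr_eq0; apply/eqP.
transitivity (x1 ^+ 2 * (l ^+ 2 - (x1 + x2 + x3))
  - x1 * (A - 2 * l * n - (x1 * x2 + x1 * x3 + x2 * x3))
  + (n ^+ 2 - B - x1 * x2 * x3)); first by ring.
by rewrite e1 e2 e3 !subrr; ring.
Qed.

(* Chords with opposite slopes through S and -S would be opposite lines, cutting
   the curve in opposite points. *)
Lemma chord_slope_neq0 xA yA xB yB xS yS xC yC xD yD l1 n1 l2 n2 :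
  chord xA yA xB yB xS (- yS) l1 n1 -> chord xS yS xC yC xD yD l2 n2 ->
  xC != xA -> xC != xB -> l1 + l2 != 0.
Proof.
case=> -[eA eB eS] [e1 e2 e3] [] [eS' eC eD] [f1 f2 f3] nCA nCB.
apply/eqP => l12.
have El : l2 = - l1 by apply/eqP; rewrite -addr_eq0 addrC l12.
have En : n2 = - n1.
  apply/eqP; rewrite -addr_eq0; apply/eqP.
  transitivity (yS - (l1 + l2) * xS + - yS - (yS - (l2 * xS + n2)) - (- yS - (l1 * xS + n1)));
    first by ring.
  by rewrite l12 -eS -eS' !subrr; ring.
have E1 : xA + xB = xC + xD.
  by apply: (addIr xS); rewrite -e1; transitivity (l2 ^+ 2); [rewrite El; ring | rewrite f1; ring].
have E2 : xA * xB = xC * xD.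
  apply: (addIr ((xA + xB) * xS)); transitivity (A - 2 * l1 * n1).
    by rewrite e2; ring.
  by transitivity (A - 2 * l2 * n2); [rewrite El En; ring | rewrite f2 E1; ring].
have /eqP : (xC - xA) * (xC - xB) = 0.
  transitivity (xC ^+ 2 - xC * (xA + xB) + xA * xB); first by ring.
  by rewrite E1 E2; ring.
by rewrite mulf_eq0 !subr_eq0 (negbTE nCA) (negbTE nCB).
Qed.

(* The function (Y - l1)(Y - l2)/(X - xS) has divisor A + B + C + D - 4 O; it
   reads G - be * Y with G = X^2 + g1 * X + g0. Substituting the line through B
   and C in it gives G = (X - xB)(X - xC) + be * (mu * X + nu), and writing
   G - (X - xA)(X - xD) = be * (ka * X + n) yields the line through A, D, U. *)
Lemma chord_assoc xA yA xB yB xS yS xC yC xD yD xU yU l1 n1 l2 n2 mu nu :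
  chord xA yA xB yB xS (- yS) l1 n1 -> chord xS yS xC yC xD yD l2 n2 ->
  chord xB yB xC yC xU (- yU) mu nu ->
  xB != xC -> l1 + l2 != 0 ->
  exists k n, chord xA yA xU yU xD yD k n.
Proof.
case=> -[eA eB eS] [e1 e2 e3] [] [eS' eC eD] [f1 f2 f3] [] [eB' eC' eU] [h1 h2 h3] nBC nb.
set be := l1 + l2 in nb *.
have z (x y : F) : x = y -> x - y = 0 by move=> ->; rewrite subrr.
have En : n1 + n2 = - be * xS.
  apply/eqP; rewrite -subr_eq0; apply/eqP.
  transitivity (- (yS - (l2 * xS + n2)) - (- yS - (l1 * xS + n1)));
    first by rewrite /be; ring.
  by rewrite ?(z _ _ eS') ?(z _ _ eS); ring.
have bem : be * l1 - xA - xB = be * l2 - xC - xD.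
  apply/eqP; rewrite -subr_eq0; apply/eqP.
  transitivity ((l1 ^+ 2 - (xA + xB + xS)) - (l2 ^+ 2 - (xS + xC + xD)));
    first by rewrite /be; ring.
  by rewrite ?(z _ _ e1) ?(z _ _ f1); ring.
pose g1 := - (xA + xB) + be * l1.
pose g0 := xA * xB + be * n1.
have g1' : g1 = - (xC + xD) + be * l2.
  by transitivity (be * l1 - xA - xB); [rewrite /g1; ring | rewrite bem; ring].
have g0' : g0 = xC * xD + be * n2.
  apply/eqP; rewrite -subr_eq0; apply/eqP.
  transitivity (- (A - 2 * l1 * n1 - (xA * xB + xA * xS + xB * xS))
   + (A - 2 * l2 * n2 - (xS * xC + xS * xD + xC * xD))
   + xS * ((l1 ^+ 2 - (xA + xB + xS)) - (l2 ^+ 2 - (xS + xC + xD)))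
   + (l1 - l2) * (- be * xS - (n1 + n2))); first by rewrite /g0 /be; ring.
  by rewrite ?(z _ _ e2) ?(z _ _ f2) ?(z _ _ e1) ?(z _ _ f1) ?(z _ _ (esym En)); ring.
have GB : xB ^+ 2 + g1 * xB + g0 = be * yB by rewrite eB /g1 /g0; ring.
have GC : xC ^+ 2 + g1 * xC + g0 = be * yC by rewrite eC g1' g0'; ring.
(* $G-(X-x_B)(X-x_C)$ and [be * (mu X + nu)] have degree at most 1 and agree at the distinct
   abscissas of B and C, so their coefficients agree. *)
have g1m : g1 = - (xB + xC) + be * mu.
  have nBC' : xB - xC != 0 by rewrite subr_eq0.
  apply: (mulIf nBC').
  apply/eqP; rewrite -subr_eq0; apply/eqP.
  transitivity ((xB ^+ 2 + g1 * xB + g0 - be * yB) - (xC ^+ 2 + g1 * xC + g0 - be * yC)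
     + be * (yB - (mu * xB + nu)) - be * (yC - (mu * xC + nu))); first by ring.
  by rewrite ?(z _ _ GB) ?(z _ _ GC) ?(z _ _ eB') ?(z _ _ eC'); ring.
have g0m : g0 = xB * xC + be * nu.
  apply/eqP; rewrite -subr_eq0; apply/eqP.
  transitivity ((xB ^+ 2 + g1 * xB + g0 - be * yB) + be * (yB - (mu * xB + nu)) - xB * (g1 - (- (xB + xC) + be * mu)));
    first by ring.
  by rewrite ?(z _ _ GB) ?(z _ _ eB') ?(z _ _ g1m); ring.
have S1 : 2 * g1 = - (xA + xB + xC + xD) + be ^+ 2.
  by transitivity (g1 + g1); [ring | rewrite {2}g1' /g1 /be; ring].
have S0 : 2 * g0 = xB * xC + xA * xD - be ^+ 2 * xU.
  have S0' : 2 * g0 = xA * xB + xC * xD - be ^+ 2 * xS.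
    apply/eqP; rewrite -subr_eq0; apply/eqP.
    transitivity ((g0 - (xC * xD + be * n2)) + be * ((n1 + n2) - (- be * xS)));
      first by rewrite /g0; ring.
    by rewrite ?(z _ _ g0') ?(z _ _ En); ring.
  rewrite S0'.
  apply/eqP; rewrite -subr_eq0; apply/eqP.
  transitivity (be ^+ 2 * ((l1 ^+ 2 - (xA + xB + xS)) - (mu ^+ 2 - (xB + xC + xU)))
   - be * (l1 + mu) * (g1 - (- (xB + xC) + be * mu))
   + (xA - xC) * (g1 - (- (xB + xC) + be * mu))
   - (xA - xC) * (be * l1 - xA - xB - (be * l2 - xC - xD)) ).
    by rewrite /g1 /be; ring.
  rewrite (z _ _ e1) (z _ _ h1) (z _ _ g1m) (z _ _ bem); ring.
pose ka := (g1 + xA + xD) / be; pose n := (g0 - xA * xD) / be.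
have bk : be * ka = g1 + xA + xD by rewrite mulrC divfK.
have bn : be * n = g0 - xA * xD by rewrite mulrC divfK.
exists ka, n; split; split; apply: (mulfI nb).
- transitivity (be * ka * xA + be * n); last by ring.
  by rewrite bk bn eA /g1 /g0; ring.
- transitivity (be * ka * xU + be * n); last by ring.
  rewrite bk bn; apply/eqP; rewrite -subr_eq0; apply/eqP.
  transitivity (- be * (- yU - (mu * xU + nu)) + xU * (g1 - (- (xB + xC) + be * mu))
    + (g0 - (xB * xC + be * nu)) - xU * (2 * g1 - (- (xA + xB + xC + xD) + be ^+ 2))
    - (2 * g0 - (xB * xC + xA * xD - be ^+ 2 * xU))); first by ring.
  by rewrite ?(z _ _ eU) ?(z _ _ g1m) ?(z _ _ g0m) ?(z _ _ S1) ?(z _ _ S0); ring.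
- transitivity (be * ka * xD + be * n); last by ring.
  by rewrite bk bn eD g1' g0'; ring.
- apply: (mulfI nb); transitivity ((be * ka) ^+ 2); first by ring.
  rewrite bk; apply/eqP; rewrite -subr_eq0; apply/eqP.
  transitivity (be ^+ 2 * (mu ^+ 2 - (xB + xC + xU))
    + (xA + xD - xB - xC) * (2 * g1 - (- (xA + xB + xC + xD) + be ^+ 2))
    + (g1 + xB + xC + be * mu) * (g1 - (- (xB + xC) + be * mu))); first by ring.
  by rewrite ?(z _ _ h1) ?(z _ _ S1) ?(z _ _ g1m); ring.
- apply: (mulfI nb); transitivity (be ^+ 2 * A - 2 * (be * ka) * (be * n));
  first by ring.
  rewrite bk bn; apply/eqP; rewrite -subr_eq0; apply/eqP.
  transitivity (be ^+ 2 * (A - 2 * mu * nu - (xB * xC + xB * xU + xC * xU))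
    - 2 * (g0 - xB * xC) * (g1 - (- (xB + xC) + be * mu))
    - 2 * be * mu * (g0 - (xB * xC + be * nu))
    + (xA * xD - xB * xC) * (2 * g1 - (- (xA + xB + xC + xD) + be ^+ 2))
    - (xA + xD - xB - xC) * (2 * g0 - (xB * xC + xA * xD - be ^+ 2 * xU)));
      first by ring.
  by rewrite ?(z _ _ h2) ?(z _ _ g1m) ?(z _ _ g0m) ?(z _ _ S1) ?(z _ _ S0); ring.
- apply: (mulfI nb); transitivity ((be * n) ^+ 2 - be ^+ 2 * B); first by ring.
  rewrite bn; apply/eqP; rewrite -subr_eq0; apply/eqP.
  transitivity (be ^+ 2 * (nu ^+ 2 - B - xB * xC * xU)
    + (g0 - xB * xC + be * nu) * (g0 - (xB * xC + be * nu))
    + (xB * xC - xA * xD) * (2 * g0 - (xB * xC + xA * xD - be ^+ 2 * xU)));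
      first by ring.
  by rewrite ?(z _ _ h3) ?(z _ _ g0m) ?(z _ _ S0); ring.
Qed.

End Chord.

Section GroupLaw.
Variables a b : rat.
Hypothesis ns : nonsingular a b.

Lemma ratr_nonsingular : 4 * (ratr a : algC) ^+ 3 + 27 * ratr b ^+ 2 != 0.
Proof.
have -> : 4 * (ratr a : algC) ^+ 3 + 27 * ratr b ^+ 2
  = ratr (4 * a ^+ 3 + 27 * b ^+ 2).
  have h (n k : nat) (c : rat) : ratr (n%:R * c ^+ k) = n%:R * ratr c ^+ k :> algC.
    by rewrite rmorphM rmorph_nat rmorphXn.
  by rewrite -(h 4%N) -(h 27%N) -(rmorphD (@ratr algC)).
by rewrite fmorph_eq0.
Qed.

Lemma eq_half_opp (y : algC) : (y == - y) = (y == 0).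
Proof. by rewrite -addr_eq0 -mulr2n mulrn_eq0. Qed.

(** A line that meets the curve twice over the same abscissa is a tangent. If it touched at a point
    with $y=0$, the cubic would have a double root there, with $A=-3x^2$ and $B=2x^3$, and its
    discriminant would vanish. *)
Lemma chord_y_neq0 (F : fieldType) (A B : F) x y y' x3 y3 l n :
  4 * A ^+ 3 + 27 * B ^+ 2 != 0 ->
  chord A B x y x y' x3 y3 l n -> y != 0.
Proof.
move=> nAB [[e e' e3] [f1 f2 f3]]; apply: contra_neq nAB => y0.
have n0 : n = - (l * x) by apply/eqP; rewrite -addr_eq0 addrC -e y0.
have eA : A = - 3 * x ^+ 2.
  transitivity ((A - 2 * l * n) + 2 * l * n); first by ring.
  rewrite f2 n0; transitivity (x ^+2 + 2 * x * x3 - 2 * x * l ^+ 2); first by ring.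
  by rewrite f1; ring.
have eB : B = 2 * x ^+ 3.
  transitivity (n ^+ 2 - (n ^+ 2 - B)); first by ring.
  rewrite f3 n0; transitivity (x ^+ 2 * l ^+ 2 - x * x * x3); first by ring.
  by rewrite f1; ring.
by rewrite eA eB; ring.
Qed.

Lemma padd_chord x1 y1 x2 y2 :
  on_curve a b (Some (x1, y1)) -> on_curve a b (Some (x2, y2)) ->
  ~~ ((x1 == x2) && (y1 == - y2)) ->
  exists x3 y3 l n, padd a (Some (x1, y1)) (Some (x2, y2)) = Some (x3, y3) /\
    chord (ratr a) (ratr b) x1 y1 x2 y2 x3 (- y3) l n.
Proof.
rewrite /on_curve /padd => /eqP c1 /eqP c2.
case: eqVneq => [e|nx] /=.
  rewrite -e in c2 * => {x2 e} ny; rewrite (negbTE ny).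
  have ey : y1 = y2.
    have : (y1 - y2) * (y1 + y2) = 0.
      by transitivity (y1 ^+ 2 - y2 ^+ 2); [ring | rewrite c1 c2 subrr].
    by move/eqP; rewrite mulf_eq0 subr_eq0 addr_eq0 (negbTE ny) orbF => /eqP.
  rewrite -{}ey in c2 ny *; rewrite eq_half_opp in ny.
  have ny2 : 2 * y1 != 0 by rewrite mulf_neq0 // pnatr_eq0.
  set l := _ / (2 * y1); set x3 := l ^+ 2 - x1 - x1.
  have lE : l * (2 * y1) = 3 * x1 ^+ 2 + ratr a by rewrite divfK.
  exists x3, (l * (x1 - x3) - y1), l, (y1 - l * x1); split=> //.
  split; split; rewrite ?/x3; try ring.
  - apply/eqP; rewrite -subr_eq0; apply/eqP.
    transitivity (- (l * (2 * y1) - (3 * x1 ^+ 2 + ratr a))); first by ring.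
    by rewrite lE subrr oppr0.
  - apply/eqP; rewrite -subr_eq0; apply/eqP.
    transitivity ((y1 ^+ 2 - (x1 ^+ 3 + ratr a * x1 + ratr b)) - x1 * (l * (2 * y1) - (3 * x1 ^+ 2 + ratr a)));
      first by ring.
    by rewrite c1 lE !subrr mulr0 subr0.
move=> _; set l := _ / (x2 - x1); set x3 := l ^+ 2 - x1 - x2.
have nx' : x2 - x1 != 0 by rewrite subr_eq0 eq_sym.
have lE : l * (x2 - x1) = y2 - y1 by rewrite divfK.
exists x3, (l * (x1 - x3) - y1), l, (y1 - l * x1); split=> //.
have y2E : y2 = y1 + l * (x2 - x1) by rewrite lE addrC subrK.
have E : y1 * 2 * l + l ^+ 2 * (x2 - x1) = x2 ^+ 2 + x1 * x2 + x1 ^+ 2 + ratr a.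
  apply: (mulIf nx'); transitivity ((y1 + l * (x2 - x1)) ^+ 2 - y1 ^+ 2); first by ring.
  by rewrite -y2E c1 c2; ring.
split; split; rewrite ?/x3; try ring.
- by rewrite y2E; ring.
- apply/eqP; rewrite -subr_eq0; apply/eqP.
  transitivity (- (y1 * 2 * l + l ^+ 2 * (x2 - x1) - (x2 ^+ 2 + x1 * x2 + x1 ^+ 2 + ratr a)));
    first by ring.
  by rewrite E subrr oppr0.
- apply/eqP; rewrite -subr_eq0; apply/eqP.
  transitivity ((y1 ^+ 2 - (x1 ^+ 3 + ratr a * x1 + ratr b)) - x1 * (y1 * 2 * l + l ^+ 2 * (x2 - x1) - (x2 ^+ 2 + x1 * x2 + x1 ^+ 2 + ratr a)));
    first by ring.
  by rewrite c1 E !subrr mulr0 subr0.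
Qed.

Lemma chord_padd x1 y1 x2 y2 x3 y3 l n :
  chord (ratr a) (ratr b) x1 y1 x2 y2 x3 y3 l n ->
  padd a (Some (x1, y1)) (Some (x2, y2)) = Some (x3, - y3).
Proof.
move=> c; rewrite /padd; case: eqVneq => [e|nx].
  rewrite -{}e in c *; have ny := chord_y_neq0 ratr_nonsingular c.
  case: c => -[e1 e2 e3] [f1 f2 f3].
  have ey : y2 = y1 by rewrite e1 e2.
  rewrite ey eq_half_opp (negbTE ny).
  have ny2 : 2 * y1 != 0 by rewrite mulf_neq0 // pnatr_eq0.
  have -> : (3 * x1 ^+ 2 + ratr a) / (2 * y1) = l.
    apply: (mulIf ny2); rewrite divfK // {1}e1.
    transitivity (3 * x1 ^+ 2 + (ratr a - 2 * l * n) + 2 * l * n); first by ring.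
    rewrite f2; transitivity (2 * (l ^+ 2 * x1 + l * n)); last by ring.
    by rewrite f1; ring.
  have -> : l ^+ 2 - x1 - x1 = x3 by rewrite f1; ring.
  by congr (Some (_, _)); rewrite e1 e3; ring.
case: c => -[e1 e2 e3] [f1 f2 f3].
have nx' : x2 - x1 != 0 by rewrite subr_eq0 eq_sym.
have -> : (y2 - y1) / (x2 - x1) = l.
  by apply: (mulIf nx'); rewrite divfK // e1 e2; ring.
have -> : l ^+ 2 - x1 - x2 = x3 by rewrite f1; ring.
by congr (Some (_, _)); rewrite e1 e3; ring.
Qed.

Lemma pnegK : involutive pneg.
Proof. by case=> [[x y]|] //=; rewrite opprK. Qed.

Lemma on_curve_pneg P : on_curve a b (pneg P) = on_curve a b P.
Proof. by case: P => [[x y]|] //=; rewrite sqrrN. Qed.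

Lemma padd0P P : padd a None P = P.
Proof. by []. Qed.

Lemma paddP0 P : padd a P None = P.
Proof. by case: P => [[]|]. Qed.

Lemma paddNP P : padd a (pneg P) P = None.
Proof. by case: P => [[x y]|] //=; rewrite !eqxx. Qed.

(** Replaces the case analysis of [padd] by a relation in which the generic case is collinearity of
    [P], [Q], [-R]. Commutativity and cancellation then reduce to permuting or negating three
    collinear points. *)
Variant padd_spec : point -> point -> point -> Prop :=
| PaddO P : padd_spec None P P
| PaddO' P : padd_spec P None P
| PaddOpp P : padd_spec (pneg P) P None
| PaddChord x1 y1 x2 y2 x3 y3 l n of
    chord (ratr a) (ratr b) x1 y1 x2 y2 x3 (- y3) l n :
    padd_spec (Some (x1, y1)) (Some (x2, y2)) (Some (x3, y3)).

Lemma paddP P Q : on_curve a b P -> on_curve a b Q ->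
  padd_spec P Q (padd a P Q).
Proof.
case: P => [[x1 y1]|] => [|_ _]; last exact: PaddO.
case: Q => [[x2 y2]|] => [|_ _]; last exact: PaddO'.
move=> c1 c2; have [/andP[/eqP-> /eqP->]|ny] := boolP ((x1 == x2) && (y1 == - y2)).
  rewrite -[Some (x2, - y2)]/(pneg (Some (x2, y2))) paddNP; exact: PaddOpp.
have [x3 [y3 [l [n [-> c]]]]] := padd_chord c1 c2 ny.
exact: PaddChord c.
Qed.

Lemma padd_specE P Q R : padd_spec P Q R -> padd a P Q = R.
Proof.
case=> {P Q R} [P|P|P|x1 y1 x2 y2 x3 y3 l n c].
- exact: padd0P.
- exact: paddP0.
- exact: paddNP.
- by rewrite (chord_padd c) opprK.
Qed.

Lemma on_curve_padd P Q :
  on_curve a b P -> on_curve a b Q -> on_curve a b (padd a P Q).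
Proof.
move=> cP cQ; case: (paddP cP cQ) (cP) (cQ) => // {P Q cP cQ} x1 y1 x2 y2 x3 y3 l n c _ _.
by apply/eqP; rewrite -sqrrN; apply: chord_curve (chord_rot (chord_rot c)).
Qed.

Lemma padd_specC P Q R : padd_spec P Q R -> padd_spec Q P R.
Proof.
case=> {P Q R} [P|P|P|x1 y1 x2 y2 x3 y3 l n c].
- exact: PaddO'.
- exact: PaddO.
- by rewrite -{1}[P]pnegK; apply: PaddOpp.
- exact: PaddChord (chord_swap c).
Qed.

Lemma paddC P Q : on_curve a b P -> on_curve a b Q -> padd a P Q = padd a Q P.
Proof. by move=> cP cQ; rewrite (padd_specE (padd_specC (paddP cQ cP))). Qed.

Lemma padd_specK P Q R : padd_spec P Q R -> padd_spec R (pneg Q) P.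
Proof.
case=> {P Q R} [P|P|P|x1 y1 x2 y2 x3 y3 l n c].
- by rewrite -{1}[P]pnegK; apply: PaddOpp.
- exact: PaddO'.
- exact: PaddO.
- have := chord_opp (chord_swap (chord_rot c)); rewrite opprK => c'.
  exact: PaddChord c'.
Qed.

Lemma paddK P Q : on_curve a b P -> on_curve a b Q ->
  padd a (padd a P Q) (pneg Q) = P.
Proof. by move=> cP cQ; apply: padd_specE; apply: padd_specK; apply: paddP. Qed.

Lemma padd_inj T P Q : on_curve a b T -> on_curve a b P -> on_curve a b Q ->
  padd a P T = padd a Q T -> P = Q.
Proof. by move=> cT cP cQ e; rewrite -(paddK cP cT) e paddK. Qed.

Definition px (P : point) : algC := if P is Some (x, _) then x else 0.

(** The conditions on [T] make [(P + Q) + T] and [Q + T] genuine chords and exclude opposite slopes,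
    which is what [chord_assoc] asks for. *)
Lemma paddA_generic P Q T :
  on_curve a b P -> on_curve a b Q -> on_curve a b T ->
  T <> None -> px T != px P -> px T != px Q -> T <> pneg (padd a P Q) ->
  padd a (padd a P Q) T = padd a P (padd a Q T).
Proof.
move=> cP cQ cT T0 nP nQ nS.
have cS := on_curve_padd cP cQ; have cU := on_curve_padd cQ cT.
case: (paddP cP cQ) (cP) (cQ) (nP) (nQ) (nS) (cS) (cU)
  => {P Q cP cQ nP nQ nS cS cU} [Q|P|Q|x1 y1 x2 y2 x3 y3 l n c] cP cQ nP nQ nS cS cU.
- by rewrite !padd0P.
- by rewrite padd0P.
- rewrite padd0P [RHS]paddC // [padd a Q T]paddC //; first by rewrite paddK.
case: T T0 cT nP nQ nS cU => // -[xT yT] _ cT nP nQ nS cU; rewrite /px in nP nQ.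
have [x4 [y4 [l2 [n2 [e2 c2]]]]] : exists x4 y4 l n,
  padd a (Some (x3, y3)) (Some (xT, yT)) = Some (x4, y4) /\
  chord (ratr a) (ratr b) x3 y3 xT yT x4 (- y4) l n.
  apply: padd_chord => //; apply/negP => /andP[/eqP e3 /eqP e4].
  by apply: nS; rewrite /pneg e3 e4 opprK.
have [xU [yU [mu [nu [eU c3]]]]] : exists x4 y4 l n,
  padd a (Some (x2, y2)) (Some (xT, yT)) = Some (x4, y4) /\
  chord (ratr a) (ratr b) x2 y2 xT yT x4 (- y4) l n.
  by apply: padd_chord => //; rewrite eq_sym (negbTE nQ).
have nb := chord_slope_neq0 c c2 nP nQ.
rewrite eq_sym in nQ.
have [k [n' c4]] := chord_assoc c c2 c3 nQ nb.
by rewrite e2 eU (chord_padd c4) opprK.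
Qed.

(** Every abscissa lifts to the curve because square roots exist, so a natural number outside a
    finite set of abscissas suffices. *)
Lemma exists_point_avoiding (s : seq point) :
  exists T, [/\ on_curve a b T, T <> None, T \notin s &
    forall P, P \in s -> px T != px P].
Proof.
pose t := map px s.
have [n nt] : exists n : nat, n%:R \notin t.
  have u : uniq [seq i%:R : algC | i <- iota 0 (size t).+1].
    rewrite map_inj_uniq ?iota_uniq // => i j /eqP.
    by rewrite eqr_nat => /eqP.
  have /allPn[x] : ~~ all (mem t) [seq i%:R : algC | i <- iota 0 (size t).+1].
    apply/negP => /allP sub; have := uniq_leq_size u sub.
    by rewrite size_map size_iota ltnn.
  by case/mapP=> i _ -> ?; exists i.
have [y ey] : exists y : algC, y ^+ 2 = n%:R ^+ 3 + ratr a * n%:R + ratr b.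
  by exists (sqrtC (n%:R ^+ 3 + ratr a * n%:R + ratr b)); rewrite sqrtCK.
have h P : P \in s -> n%:R != px P.
  by move=> sP; apply: contraNneq nt => ->; apply: map_f.
exists (Some (n%:R, y)); split=> //; first by rewrite /= ey.
by apply/negP => /h; rewrite eqxx.
Qed.

(* Both bracketings agree after adding a sufficiently generic point T, which can
   then be cancelled. *)
Lemma paddA P Q R : on_curve a b P -> on_curve a b Q -> on_curve a b R ->
  padd a (padd a P Q) R = padd a P (padd a Q R).
Proof.
move=> cP cQ cR.
have cPQ := on_curve_padd cP cQ; have cQR := on_curve_padd cQ cR.
pose S := padd a P Q; pose U := padd a Q R.
pose bad := [:: P; Q; S; R; U; pneg (padd a S R); pneg S; pneg (padd a P U);
  pneg U].
(* Avoiding the points [X - R] makes [R + T] itself generic with respect to [P] and [Q]. *)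
pose bad' := [seq padd a X (pneg R) | X <- [:: P; pneg P; Q; pneg Q; pneg S; None]].
have [T [cT T0 Tbad Tx]] := exists_point_avoiding (bad ++ bad').
have xT X : X \in bad -> px T != px X by move=> h; apply: Tx; rewrite mem_cat h.
have nT X : X \in bad -> T <> X.
  by move=> h e; move: Tbad; rewrite mem_cat -e in h *; rewrite h.
have cRT := on_curve_padd cR cT.
have cN X : on_curve a b X -> on_curve a b (pneg X) by rewrite on_curve_pneg.
have nRT X : on_curve a b X -> X \in [:: P; pneg P; Q; pneg Q; pneg S; None] ->
  padd a R T <> X.
  move=> cX hX e; move: Tbad; rewrite mem_cat negb_or => /andP[_ /negP]; apply.
  by apply/mapP; exists X; rewrite // -e (paddC cR cT) paddK.
have px_eq X Y : on_curve a b X -> on_curve a b Y -> X <> None -> Y <> None ->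
  px X = px Y -> X = Y \/ X = pneg Y.
  case: X Y => [[x y]|] [[x' y']|] //= /eqP e1 /eqP e2 _ _ exx.
  have : (y - y') * (y + y') = 0.
    by transitivity (y ^+ 2 - y' ^+ 2); [ring | rewrite e1 e2 exx subrr].
  move/eqP; rewrite mulf_eq0 subr_eq0 addr_eq0 exx.
  by case/orP => /eqP ->; [left | right].
have xRT X : on_curve a b X -> X <> None -> X \in [:: P; Q] -> px (padd a R T) != px X.
  move=> cX X0 hX; apply/eqP => /px_eq; case=> //.
  - by apply: nRT; rewrite ?inE ?eqxx ?orbT.
  - by apply: nRT => //; move: hX; rewrite !inE => /orP[]/eqP->; rewrite eqxx ?orbT.
  - by apply: nRT; rewrite ?cN //; move: hX; rewrite !inE => /orP[]/eqP->; rewrite eqxx ?orbT.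
have cS := cPQ; have cU := cQR.
apply: (padd_inj cT); rewrite ?on_curve_padd //.
rewrite (paddA_generic cPQ cR cT) ?xT ?inE ?eqxx ?orbT //; last first.
  by apply: nT; rewrite !inE eqxx ?orbT.
rewrite (paddA_generic cP cU cT) ?xT ?inE ?eqxx ?orbT //; last first.
  by apply: nT; rewrite !inE eqxx ?orbT.
rewrite (paddA_generic cQ cR cT) ?xT ?inE ?eqxx ?orbT //; last first.
  by apply: nT; rewrite !inE eqxx ?orbT.
(* What remains is associativity for [P], [Q] and the generic point [R + T]. *)
case: (eqVneq P None) => [->|/eqP P0]; first by rewrite !padd0P.
case: (eqVneq Q None) => [->|/eqP Q0]; first by rewrite paddP0 padd0P.
apply: paddA_generic => //.
- by apply: nRT; rewrite ?inE ?eqxx ?orbT.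
- by apply: xRT; rewrite ?inE ?eqxx ?orbT.
- by apply: xRT; rewrite ?inE ?eqxx ?orbT.
- by apply: nRT; rewrite ?cN ?inE ?eqxx ?orbT.
Qed.

End GroupLaw.

(** The proof of nonsingularity is a parameter of the type, so that the group structure declared on
    it can invoke associativity. *)
Definition ecpoint (a b : rat) (ns : nonsingular a b) : Type :=
  {P : point | on_curve a b P}.

(** * The points of the curve as an abelian group with Galois action *)

Section PointGroup.
Variables (a b : rat) (ns : nonsingular a b).
Local Notation E := (ecpoint ns).
Local Notation gact := Defs.gact.

HB.instance Definition _ := Choice.copy E {P : point | on_curve a b P}.

Lemma sval_inj (P Q : E) : sval P = sval Q -> P = Q.
Proof. exact: (@val_inj _ _ {P : point | on_curve a b P}). Qed.

Definition ecadd (P Q : E) : E :=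
  exist _ (padd a (sval P) (sval Q)) (on_curve_padd (svalP P) (svalP Q)).
Definition ecopp (P : E) : E :=
  exist _ (pneg (sval P)) (etrans (on_curve_pneg a b (sval P)) (svalP P)).
Definition ec0 : E := exist _ None isT.

Lemma ecaddA : associative ecadd.
Proof. by move=> P Q R; apply: sval_inj; rewrite /= (paddA ns (svalP P) (svalP Q) (svalP R)). Qed.
Lemma ecaddC : commutative ecadd.
Proof. by move=> P Q; apply: sval_inj; exact: (paddC ns (svalP P) (svalP Q)). Qed.
Lemma ecadd0 : left_id ec0 ecadd.
Proof. by move=> P; apply: sval_inj. Qed.
Lemma ecaddN : left_inverse ec0 ecopp ecadd.
Proof. by move=> P; apply: sval_inj; rewrite /= paddNP. Qed.

HB.instance Definition _ := GRing.isZmodule.Build E ecaddA ecaddC ecadd0 ecaddN.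

Lemma sval_ecD (P Q : E) : sval (P + Q) = padd a (sval P) (sval Q).
Proof. by []. Qed.

Lemma sval_ecMn (P : E) n : sval (P *+ n) = pmuln a n (sval P).
Proof. by elim: n => // n IHn; rewrite mulrS sval_ecD IHn. Qed.

Lemma torsE n (P : E) : tors a b n (sval P) = (P *+ n == 0).
Proof.
rewrite /tors (svalP P) /=; apply/eqP/eqP => [e|e].
  by apply: sval_inj; rewrite /= sval_ecMn.
by rewrite -sval_ecMn e.
Qed.

Lemma tors_ec n P : tors a b n P -> exists2 R : E, sval R = P & R *+ n = 0.
Proof.
move=> t; have cP : on_curve a b P by case/andP: t.
exists (exist _ P cP : E) => //.
by apply/eqP; rewrite -torsE.
Qed.

Lemma gact_padd (s : {rmorphism algC -> algC}) P Q :
  gact s (padd a P Q) = padd a (gact s P) (gact s Q).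
Proof.
case: P => [[x1 y1]|] //; case: Q => [[x2 y2]|] //.
rewrite /padd /gact -rmorphN !fmorph_eq.
case: eqP => _; [case: eqP => _ //|]; congr (Some (_, _));
  by rewrite !(rmorphB, rmorphXn, fmorphV, fmorph_rat, rmorph_nat, rmorphM, rmorphD) .
Qed.

Lemma on_curve_gact (s : {rmorphism algC -> algC}) P :
  on_curve a b P -> on_curve a b (gact s P).
Proof.
case: P => [[x y]|] //= /eqP e; apply/eqP; rewrite -rmorphXn /= e.
by rewrite !rmorphD rmorphXn rmorphM !fmorph_rat.
Qed.

Definition galE (s : {rmorphism algC -> algC}) (P : E) : E :=
  exist _ (gact s (sval P)) (on_curve_gact s (svalP P)).

Lemma galE_nmod_morphism s : nmod_morphism (galE s).
Proof.
by split=> [|P Q]; apply: sval_inj => //=; rewrite gact_padd.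
Qed.

HB.instance Definition _ s := GRing.isNmodMorphism.Build E E (galE s)
  (galE_nmod_morphism s).

Lemma galE_comp (s t : {rmorphism algC -> algC}) P :
  galE (s \o t : {rmorphism algC -> algC}) P = galE s (galE t P).
Proof. by apply: sval_inj => /=; case: (sval P) => [[]|]. Qed.

Lemma galE_id P : galE (idfun : {rmorphism algC -> algC}) P = P.
Proof. by apply: sval_inj => /=; case: (sval P) => [[]|]. Qed.

End PointGroup.

Lemma ord2_ind (T : 'I_2 -> Prop) : T 0 -> T 1 -> forall i, T i.
Proof.
move=> T0 T1 [[|[|k]] h] //; [rewrite (_ : Ordinal h = 0) //|
  rewrite (_ : Ordinal h = 1) //]; exact: val_inj.
Qed.

(** * Residues modulo m and matrices with respect to a torsion basis *)

Section ZmodVal.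
Variables (m : nat) (m_gt1 : (1 < m)%N).

Lemma Zp_val_add d (x y : 'Z_m) : (d %| m)%N ->
  (((x + y)%R : nat) = x + y %[mod d])%N.
Proof. by move=> dm; apply: modn_dvdm; rewrite Zp_cast. Qed.

Lemma Zp_val_mul d (x y : 'Z_m) : (d %| m)%N ->
  (((x * y)%R : nat) = x * y %[mod d])%N.
Proof. by move=> dm; apply: modn_dvdm; rewrite Zp_cast. Qed.

Lemma Zp_val_nat d k : (d %| m)%N -> (((k%:R : 'Z_m)%R : nat) = k %[mod d])%N.
Proof. by move=> dm; rewrite val_Zp_nat // modn_dvdm. Qed.

Lemma Zp_val_lt (x : 'Z_m) : (x < m)%N.
Proof. by rewrite -[X in (_ < X)%N]Zp_cast. Qed.

Lemma Zp_val_inj (x y : 'Z_m) : ((x : nat) = y %[mod m])%N -> x = y.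
Proof. by rewrite !modn_small ?Zp_val_lt // => /val_inj. Qed.

Definition mxcongr d (u v : 'M['Z_m]_2) : Prop :=
  forall i j, ((u i j : nat) = v i j %[mod d])%N.

End ZmodVal.

Section TorsionBasis.
Variables (V : zmodType) (m : nat) (p q : V).
Hypothesis m_gt1 : (1 < m)%N.
Hypotheses (pm : p *+ m = 0) (qm : q *+ m = 0).
Hypothesis basis : forall r, r *+ m = 0 -> exists! ij : nat * nat,
  [/\ (ij.1 < m)%N, (ij.2 < m)%N & r = p *+ ij.1 + q *+ ij.2].

Let m_gt0 : (0 < m)%N := ltnW m_gt1.

Lemma mulrn_modn (r : V) k d : r *+ d = 0 -> r *+ (k %% d)%N = r *+ k.
Proof.
by move=> rd; rewrite [in RHS](divn_eq k d) mulrnDr mulnC mulrnA rd mul0rn add0r.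
Qed.

Lemma mulrn_congr (r : V) k l d : r *+ d = 0 -> (k = l %[mod d])%N ->
  r *+ k = r *+ l.
Proof. by move=> rd kl; rewrite -(mulrn_modn k rd) kl mulrn_modn. Qed.

Lemma basis_uniq i j i' j' :
  p *+ i + q *+ j = p *+ i' + q *+ j' ->
  ((i = i' %[mod m]) /\ (j = j' %[mod m]))%N.
Proof.
move=> e; have [|[k l] [_ kl]] := basis (r := p *+ i + q *+ j).
  by rewrite mulrnDl -!mulrnA !(mulnC _ m) !mulrnA pm qm !mul0rn addr0.
have h1 : (k, l) = (i %% m, j %% m)%N.
  by apply: kl; rewrite /= !ltn_mod !mulrn_modn.
have h2 : (k, l) = (i' %% m, j' %% m)%N.
  by apply: kl; rewrite /= !ltn_mod !mulrn_modn.
by move: h1; rewrite h2 => -[-> ->].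
Qed.

(** Carries [m]-torsion to [d]-torsion; for every [d] dividing [m] the images of [p] and [q] form a
    basis of the [d]-torsion. *)
Definition tmul d (r : V) := r *+ (m %/ d)%N.

Lemma tmulK d r : (d %| m)%N -> r *+ m = 0 -> tmul d r *+ d = 0.
Proof. by move=> dm rm; rewrite -mulrnA divnK. Qed.

Lemma tbasis_uniq d i j i' j' : (d %| m)%N ->
  tmul d p *+ i + tmul d q *+ j = tmul d p *+ i' + tmul d q *+ j' ->
  ((i = i' %[mod d]) /\ (j = j' %[mod d]))%N.
Proof.
move=> dm; rewrite -!mulrnA => /basis_uniq[].
have md_gt0 : (0 < m %/ d)%N by rewrite divn_gt0 ?(dvdn_gt0 m_gt0) // dvdn_leq.
rewrite -{2 4 6 8}(divnK dm) -!muln_modr.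
by move=> /eqP; rewrite eqn_pmul2l // => /eqP-> /eqP; rewrite eqn_pmul2l // => /eqP.
Qed.

(** If $r=ip+jq$ is killed by $d$, uniqueness of coordinates gives $m\mid id$ and $m\mid jd$, so
    $m/d$ divides $i$ and $j$. *)
Lemma tbasis_span d r : (d %| m)%N -> r *+ d = 0 ->
  exists i j, r = tmul d p *+ i + tmul d q *+ j.
Proof.
move=> dm rd; have rm : r *+ m = 0 by rewrite -(divnK dm) mulnC mulrnA rd mul0rn.
have [[i j] [[/= _ _ e] _]] := basis rm.
have : p *+ (i * d)%N + q *+ (j * d)%N = p *+ 0 + q *+ 0.
  by rewrite !mulrnA -mulrnDl -e rd mulr0n addr0.
have d_gt0 := dvdn_gt0 m_gt0 dm.
case/basis_uniq; rewrite mod0n => /eqP h1 /eqP h2; move: h1 h2.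
rewrite -!/(dvdn _ _) -{1 2}(divnK dm) !dvdn_pmul2r //.
move=> /dvdnP[i' Di] /dvdnP[j' Dj]; exists i', j'.
by rewrite e Di Dj [X in p *+ X]mulnC [X in q *+ X]mulnC !mulrnA.
Qed.

(** One matrix over $\mathbb{Z}/m$ serves every level [d] dividing [m]: its entries act as natural
    numbers, and only their residues mod [d] matter. *)
Definition mxrep d (f : V -> V) (u : 'M['Z_m]_2) : Prop :=
  f (tmul d p) = tmul d p *+ u 0 0 + tmul d q *+ u 1 0 /\
  f (tmul d q) = tmul d p *+ u 0 1 + tmul d q *+ u 1 1.

Lemma mxrep_exists (f : {additive V -> V}) : exists u, mxrep m f u.
Proof.
have tm r : tmul m r = r by rewrite /tmul divnn m_gt0 mulr1n.
have [||i [j e]] := @tbasis_span m (f p); rewrite // -?raddfMn /= ?pm ?raddf0 //.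
have [||k [l e']] := @tbasis_span m (f q); rewrite // -?raddfMn /= ?qm ?raddf0 //.
pose r := \matrix_(x < 2, y < 2) (if y == 0 then (if x == 0 then i else j)
  else if x == 0 then k else l)%:R : 'M['Z_m]_2.
have tmm s t : s *+ m = 0 -> tmul m s *+ (t%:R : 'Z_m) = tmul m s *+ t.
  by move=> h; apply: (@mulrn_congr _ _ _ m); rewrite ?tm // Zp_val_nat.
by exists r; rewrite /mxrep !mxE /= !tmm // !(tm p, tm q) e e' !(tm p, tm q).
Qed.

Lemma raddf_comb (f : {additive V -> V}) r s i j :
  f (r *+ i + s *+ j) = f r *+ i + f s *+ j.
Proof. by rewrite raddfD !raddfMn. Qed.

Lemma mxrep_dvd d (f : {additive V -> V}) u :
  (d %| m)%N -> mxrep m f u -> mxrep d f u.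
Proof.
move=> dm; rewrite /mxrep /tmul divnn m_gt0 !mulr1n => -[e1 e2].
by rewrite !raddfMn /= e1 e2 !mulrnDl -!mulrnA ![(_ * (m %/ d))%N]mulnC.
Qed.

Lemma mxrep_congr d f u v : (d %| m)%N ->
  mxrep d f u -> mxrep d f v <-> mxcongr d u v.
Proof.
move=> dm [e1 e2]; split => [[e1' e2'] i j|c].
  have [h1 h3] := tbasis_uniq dm (etrans (esym e1) e1').
  have [h2 h4] := tbasis_uniq dm (etrans (esym e2) e2').
  by move: i j; apply: ord2_ind; apply: ord2_ind.
rewrite /mxrep e1 e2.
by split; congr (_ + _); apply: (@mulrn_congr _ _ _ d); rewrite ?tmulK //; apply: c.
Qed.

Lemma mxrep_comp d (f g : {additive V -> V}) u v : (d %| m)%N ->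
  mxrep d f u -> mxrep d g v -> mxrep d (f \o g) (u *m v).
Proof.
move=> dm [f1 f2] [g1 g2].
have E (r : V) (i j x y : 'Z_m) : r *+ d = 0 ->
  r *+ (x * i + y * j : 'Z_m)%R = r *+ x *+ i + r *+ y *+ j.
  move=> rd; rewrite -!mulrnA -mulrnDr; apply: (mulrn_congr rd).
  by rewrite Zp_val_add // -modnDm !Zp_val_mul // modnDm.
have S (x y : 'I_2) : (u *m v) x y = u x 0 * v 0 y + u x 1 * v 1 y.
  by rewrite mxE !big_ord_recl big_ord0 addr0; congr (_ + u _ _ * v _ _); apply/val_inj.
rewrite /mxrep /= g1 g2 !raddf_comb f1 f2 !S !E ?tmulK //.
by split; rewrite !mulrnDl addrACA.
Qed.

Lemma mxrep_id d : mxrep d idfun 1%:M.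
Proof.
by rewrite /mxrep !mxE /= Zp_cast // !modn_small ?mulr1n ?mulr0n ?addr0 ?add0r.
Qed.

Lemma mxrep_eq_on d (f g : {additive V -> V}) u v : (d %| m)%N ->
  mxrep d f u -> mxrep d g v ->
  (forall r, r *+ d = 0 -> f r = g r) <-> mxcongr d u v.
Proof.
move=> dm fu gv; rewrite -(mxrep_congr v dm fu); split=> [e|fv r rd].
  by rewrite /mxrep !e ?tmulK.
have [i [j ->]] := tbasis_span dm rd.
case: fv gv => f1 f2 [g1 g2].
by rewrite !raddf_comb f1 f2 g1 g2.
Qed.

End TorsionBasis.

(** * Degrees of number fields and counts of automorphisms *)

Section GaloisCount.

Local Notation QtoC := (map_poly (@ratr algC)).

(** All roots of the product of the minimal polynomials are adjoined, which makes [L] normal over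
    the rationals; embeddings of its subfields are then restrictions of elements of its Galois
    group. *)
Lemma num_field_splitting (t : seq algC) :
  exists (L : splittingFieldType rat) (LC : {rmorphism L -> algC}) (t1 : seq L),
    map LC t1 = t.
Proof.
pose P := \prod_(x <- t) sval (minCpolyP x).
have PE : QtoC P = \prod_(x <- t) minCpoly x.
  rewrite rmorph_prod; apply: eq_bigr => x _.
  by case: (minCpolyP x) => p /= [-> _].
have Pmon : P \is monic.
  by apply: monic_prod => x _; case: (minCpolyP x) => p /= [_ []].
have [r] := closed_field_poly_normal (QtoC P).
rewrite (monicP _) ?map_monic // scale1r => Pr.
have [L [LC [r1 Er1 gen_r1]]] := num_field_exists r.
pose pL := \prod_(x <- r1) ('X - x%:P).
have pLE : map_poly LC pL = QtoC P.
  rewrite Pr -Er1 big_map rmorph_prod; apply: eq_bigr => x _.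
  by rewrite /= map_polyXsubC.
have pL1 : pL \is a polyOver 1%VS.
  apply/polyOverP => i; apply/vlineP; exists P`_i.
  apply: (fmorph_inj LC); rewrite alg_num_field fmorph_rat -coef_map pLE.
  by rewrite coef_map.
have axL : SplittingField.axiom L.
  by exists pL => //; exists r1; rewrite ?eqpxx.
pose LS : splittingFieldType rat := HB.pack L (FieldExt_isSplittingField.Build rat L axL).
have sub x : x \in t -> exists y : L, LC y = x.
  move=> tx; have : x \in r.
    by rewrite -root_prod_XsubC -Pr PE (big_rem x tx) /= rootM root_minCpoly.
  by rewrite -Er1 => /mapP[y _ ->]; exists y.
exists LS, LC.
have {PE P Pmon Pr pLE pL1} : exists t1 : seq L, map LC t1 = t.
  elim: t sub {PE P Pmon Pr pLE pL1} => [|x t IHt] sub; first by exists [::].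
  have [|t1 <-] := IHt; first by move=> z tz; apply: sub; rewrite inE tz orbT.
  by have [|y <-] := sub x; [rewrite mem_head | exists (y :: t1)].
by case=> t1 e; exists t1.
Qed.

Variables (K : algC -> Prop) (d : nat).
Hypotheses (fK : subfield_pred K) (degK : field_deg K d).

Lemma subfield_predD x y : K x -> K y -> K (x + y).
Proof.
case: fK => _ KB _ _ Kx Ky.
have K0 : K 0 by rewrite -(subrr x); apply: (KB).
by rewrite -[y]opprK -[- y]sub0r; apply: (KB) => //; apply: (KB).
Qed.

Lemma subfield_pred0 : K 0.
Proof. by case: fK => K1 KB _ _; rewrite -(subrr 1); apply: (KB). Qed.

Lemma subfield_pred_rat q : K (ratr q).
Proof.
case: fK => K1 KB KM KV.
have Kn n : K n%:R.
  by elim: n => [|n IHn]; [apply: subfield_pred0 | rewrite mulrS; apply: subfield_predD].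
have Kz (z : int) : K z%:~R.
  case: z => n; first exact: Kn.
  by rewrite NegzE rmorphN -sub0r; apply: (KB); [apply: subfield_pred0 | apply: (Kn)].
by rewrite /ratr; apply: (KM) => //; apply: (KV).
Qed.

(** An independent family of maximal size spans: after adjoining [z] there is a linear relation, and
    its coefficient at [z] cannot vanish. *)
Lemma field_deg_basis : exists t : seq algC,
  [/\ size t = d, Q_linindep t & forall z, K z <-> z \in Crat_span t].
Proof.
case: degK => -[t [szt Kt indt] maxt]; exists t; split=> // z; split; last first.
  case: fK => K1 KB KM KV; case/Crat_spanP => c ->.
  apply: (big_ind K); [exact: subfield_pred0 | exact: subfield_predD |] => i _.
  by apply: (KM); [apply: subfield_pred_rat | apply: Kt; apply: mem_nth].
move=> Kz; have := maxt (z :: t); rewrite /= szt => /(_ erefl).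
have Kzt : forall x, x \in z :: t -> K x.
  by move=> x; rewrite inE => /predU1P[->|/Kt].
move=> /(_ Kzt) {Kzt}.
move=> nind; apply: contrapT => nz; apply: nind => -[|c0 c] //= [szc].
rewrite big_ord_recl /= => eq0.
have [c00|nc0] := eqVneq c0 0.
  have c_0 : forall i, c`_i = 0.
    apply: indt; rewrite ?szc //; rewrite -[RHS]eq0 c00 rmorph0 mul0r add0r.
    exact: eq_bigr.
  by case=> [|i] /=.
case: nz; apply/Crat_spanP; exists [ffun i : 'I_(size t) => - (c`_i / c0)].
have nc0' : ratr c0 != 0 :> algC by rewrite fmorph_eq0.
have {}eq0 : ratr c0 * z = - \sum_(i < size t) ratr c`_i * t`_i.
  by apply/eqP; rewrite -addr_eq0; apply/eqP; rewrite -[RHS]eq0; congr (_ + _).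
apply: (mulfI nc0'); rewrite eq0 mulr_sumr -sumrN; apply: eq_bigr => i _.
rewrite ffunE rmorphN fmorph_div mulNr mulrN; congr (- _).
by rewrite mulrA [ratr c0 * _]mulrC divfK.
Qed.

(** A primitive element [th] of $K$ has a minimal polynomial of degree [d] with distinct roots
    $g(\mathrm{th})$, for certain $g$ in the Galois group of a normal closure; extending these $g$
    to $\overline{\mathbb{Q}}$ gives the list. *)
Lemma field_deg_embeddings : exists s : seq {rmorphism algC -> algC},
  [/\ size s = d,
      forall i j, (i < d)%N -> (j < d)%N -> i <> j -> exists2 z, K z &
        nth idfun (map (fun f : {rmorphism algC -> algC} => fun x => f x) s) i z <>
        nth idfun (map (fun f : {rmorphism algC -> algC} => fun x => f x) s) j z
    & forall sg : {rmorphism algC -> algC}, exists2 i, (i < d)%N &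
        forall z, K z -> sg z =
        nth idfun (map (fun f : {rmorphism algC -> algC} => fun x => f x) s) i z].
Proof.
have [t [szt indt Kt]] := field_deg_basis.
have [L [LC [t1 Et]]] := num_field_splitting t.
subst t; rewrite size_map in szt.
pose W := <<t1>>%VS.
have comb (c : nat -> rat) :
    LC (\sum_(i < size t1) c i *: t1`_i) = \sum_(i < size t1) ratr (c i) * (map LC t1)`_i.
  rewrite rmorph_sum; apply: eq_bigr => i _ /=.
  by rewrite rmorphZ_num (nth_map 0).
have KW1 z : K z -> exists2 x, x \in W & z = LC x.
  move/Kt/Crat_spanP => [c ->]; pose c' k := if insub k is Some i then c i else 0.
  exists (\sum_(i < size t1) c' i *: t1`_i).
    by apply: memv_suml => i _; rewrite memvZ ?memv_span ?mem_nth.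
  rewrite comb -(size_map LC t1); apply: eq_bigr => i _; congr (ratr _ * _).
  by rewrite /c' valK.
have KW2 x : x \in W -> K (LC x).
  rewrite /W -[t1]/(tval (in_tuple t1)) => /coord_span ->.
  rewrite rmorph_sum; apply: (big_ind K); [exact: subfield_pred0 | exact: subfield_predD |] => i _.
  rewrite /= rmorphZ_num; case: fK => K1 KB KM KV; apply: (KM).
    exact: subfield_pred_rat.
  by apply/Kt; apply: mem_Crat_span; rewrite map_f // mem_nth.
have dimW : \dim W = d.
  rewrite -szt; apply/eqP; rewrite -/(free t1) -[t1]/(tval (in_tuple t1)).
  apply/freeP => k k0 i.
  pose c := [seq k i | i <- enum 'I_(size t1)].
  have cE (j : 'I_(size t1)) : c`_j = k j.
    by rewrite (nth_map j) ?size_enum_ord // nth_ord_enum.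
  rewrite -cE; apply: indt; first by rewrite size_map size_enum_ord size_map.
  rewrite size_map -(comb (fun i => c`_i)) -[RHS](rmorph0 LC); congr (LC _).
  by rewrite -[RHS]k0; apply: eq_bigr => j _; rewrite cE.
(* [W] contains 1 and is closed under products because $K$ is, so the algebra it generates is [W]
   itself; this turns a vector space into a subfield. *)
pose E := agenv_aspace W.
have EW : E = W :> {vspace L}.
  apply/eqP; rewrite eqEsubv sub_agenv andbT; apply: agenv_sub_modl.
    rewrite -memvE; case: (KW1 1); first by case: fK.
    by move=> x Wx e; rewrite (_ : 1 = x) //; apply: (fmorph_inj LC); rewrite rmorph1.
  apply/prodvP => x y Wx Wy; case: (KW1 (LC x * LC y)).
    by case: fK => _ _ KM _; apply: (KM); apply: KW2.
  by move=> z Wz e; rewrite (_ : x * y = z) //; apply: (fmorph_inj LC); rewrite rmorphM.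
have sep1 : forall x : L, separable_element 1 x.
  by apply: pcharf0_separable => p; rewrite pchar_lalg pchar_num.
pose th := separable_generator 1 E.
have Eth : E = <<1; th>>%VS :> {vspace L}.
  apply: eq_adjoin_separable_generator; last exact: sub1v.
  by apply/separableP => y _.
have gal1 : galois 1 {:L}.
  by apply/and3P; split; [exact: sub1v | apply/separableP | exact: normalFieldf].
have [r /= [_ Ur mE]] := elimT (galois_factors (sub1v _)) gal1 th (memvf th).
have szr : size r = d.
  have : size (minPoly 1 th) = d.+1.
    by rewrite size_minPoly adjoin_degreeE -Eth EW dimv1 divn1 dimW.
  by rewrite mE size_prod_XsubC size_map => -[].
pose ext (g : gal_of {:L}) := extend_algC_subfield_aut LC g.
pose s := [seq sval (ext g) | g <- r].
have szs : size s = d by rewrite size_map.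
have sE i x : (i < d)%N ->
  nth idfun [seq (fun x => (f : {rmorphism algC -> algC}) x) | f <- s] i (LC x) =
  LC (nth 1%g r i x).
  move=> id; rewrite (nth_map (idfun : {rmorphism _ -> _})) ?szs //.
  rewrite (nth_map 1%g) ?szr //; case: (ext _) => /= f ->.
  by [].
exists s; split=> //.
  move=> i j id jd ij; exists (LC th); first by apply: KW2; rewrite -EW Eth memv_adjoin.
  rewrite !sE // => /fmorph_inj /eqP; apply/negP.
  rewrite -!(nth_map _ 0 (fun g : gal_of {:L} => g th)) ?szr //.
  by rewrite nth_uniq ?size_map ?szr //; apply/eqP.
(* An automorphism sends [th] to one of the listed roots, and that value determines it on all
   polynomials in [th], hence on $K$. *)
move=> sg; have : root (map_poly (sg \o LC) (minPoly 1 th)) (sg (LC th)).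
  by rewrite fmorph_root root_minPoly.
rewrite map_Qnum_poly ?minPolyOver // mE rmorph_prod big_map /=.
under eq_bigr do rewrite map_polyXsubC.
rewrite -(big_map (fun g : gal_of {:L} => LC (g th)) xpredT (fun x => 'X - x%:P)).
rewrite root_prod_XsubC => /(nthP 0)[i]; rewrite size_map szr => id.
rewrite (nth_map 1%g) ?szr // => e; exists i => // z /KW1[x].
rewrite -EW Eth => /Fadjoin_polyP[p p1 ->] ->; rewrite sE //.
rewrite -[sg _]/((sg \o LC) p.[th]) -horner_map /= map_Qnum_poly // -e.
rewrite -(sE i th) // (nth_map (idfun : {rmorphism _ -> _})) ?szs //.
set f := nth _ s i.
rewrite -sE // (nth_map (idfun : {rmorphism _ -> _})) ?szs // -/f.
by rewrite -[f (LC p.[th])]/((f \o LC) p.[th]) -horner_map /= map_Qnum_poly.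
Qed.

End GaloisCount.

Local Notation gact := Defs.gact.

Lemma QE_subfield a b n : subfield_pred (QE a b n).
Proof.
split=> [K|x y Kx Ky K|x y Kx Ky K|x Kx K] fK tK; case: (fK) => K1 KB KM KV //.
- by apply: (KB); [apply: Kx | apply: Ky].
- by apply: (KM); [apply: Kx | apply: Ky].
- by apply: (KV); apply: Kx.
Qed.

(** The set where two automorphisms agree is a subfield, and [QE] is the least subfield containing
    the coordinates of the torsion points. *)
Lemma eq_on_QE a b n (s t : {rmorphism algC -> algC}) :
  (forall P, tors a b n P -> gact s P = gact t P) <->
  (forall z, QE a b n z -> s z = t z).
Proof.
split=> [eqP z Kz|eqK [[x y]|] // tP].
  apply: (Kz (fun z => s z = t z)); last by move=> x y /eqP [].
  split=> [|x y sx sy|x y sx sy|x sx]; first by rewrite !rmorph1.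
  - by rewrite !rmorphB sx sy.
  - by rewrite !rmorphM sx sy.
  - by rewrite !fmorphV sx.
by rewrite /= !eqK // => K fK tK; case: (tK _ _ tP).
Qed.

(** Translates the degrees into the counts of Galois actions in which [split] is phrased. *)
Lemma field_deg_gal_card a b n d :
  field_deg (QE a b n) d -> gal_card a b n d.
Proof.
move/(field_deg_embeddings (QE_subfield a b n)) => [s [szs sD sA]].
have nthE i : (i < d)%N ->
    nth idfun [seq (fun x => (f : {rmorphism algC -> algC}) x) | f <- s] i =
    nth (idfun : {rmorphism algC -> algC}) s i.
  by move=> id; rewrite (nth_map (idfun : {rmorphism _ -> _})) ?szs.
exists s; split=> // [i j id jd ij|sg].
  have [z Kz] := sD i j id jd ij; rewrite !nthE // => nz.
  apply: contrapT => np; apply: nz; apply: (eq_on_QE a b n _ _).1 Kz => P tP.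
  by apply: contrapT => nP; apply: np; exists P.
have [i id e] := sA sg; exists i; split=> // P tP; rewrite nthE //.
by apply: (eq_on_QE a b n _ _).2 tP => z Kz; rewrite e // nthE.
Qed.

Lemma field_deg_gt0 a b n d : field_deg (QE a b n) d -> (0 < d)%N.
Proof.
case/field_deg_gal_card => s [_ _ /(_ (idfun : {rmorphism algC -> algC}))[i [id _]]].
exact: leq_ltn_trans id.
Qed.

(** * Characters of the quotient of a subgroup of a product *)

Section AlternatingSum.
Variable F : comPzRingType.

(** This is $\sum_{B\subseteq r}(-1)^{|B|}g(B)$, as [altsum_sublists] confirms. For [B] the set of
    primes of a square-free $n$ the sign is $\mu(n)$; the recursive form makes Euler factors split
    off by induction. *)
Fixpoint altsum (r : seq nat) (g : seq nat -> F) : F :=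
  if r is p :: r' then altsum r' g - altsum r' (fun B => g (p :: B))
  else g [::].

Lemma eq_altsum r g h :
  (forall B, subseq B r -> g B = h B) -> altsum r g = altsum r h.
Proof.
elim: r g h => [|p r IHr] g h e /=; first exact: e.
congr (_ - _); apply: IHr => B sB; apply: e; last by rewrite /= eqxx.
exact: subseq_trans sB (subseq_cons r p).
Qed.

Lemma altsumZ r c g : altsum r (fun B => c * g B) = c * altsum r g.
Proof. by elim: r g => [|p r IHr] g //=; rewrite !IHr mulrBr. Qed.

Lemma altsum_sum (I : finType) r (g : I -> seq nat -> F) :
  altsum r (fun B => \sum_i g i B) = \sum_i altsum r (g i).
Proof. by elim: r g => [|p r IHr] g //=; rewrite !IHr -sumrB. Qed.

Lemma altsum_cat r1 r2 g :
  altsum (r1 ++ r2) g = altsum r1 (fun B1 => altsum r2 (fun B2 => g (B1 ++ B2))).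
Proof. by elim: r1 g => [|p r1 IHr] g //=; rewrite !IHr. Qed.

Lemma altsum_prod r (al be : nat -> F) : uniq r ->
  altsum r (fun B => \prod_(l <- r) (if l \in B then al l else be l))
  = \prod_(l <- r) (be l - al l).
Proof.
elim: r => [|p r IHr] /=; first by rewrite !big_nil.
case/andP=> pr ur; rewrite big_cons -(IHr ur) mulrBl -!altsumZ.
congr (_ - _); apply: eq_altsum => B sB; rewrite big_cons ?mem_head.
  by rewrite ifN //; apply: contra pr; apply: mem_subseq.
congr (_ * _); rewrite !big_seq; apply: eq_bigr => l lr.
by rewrite inE; case: eqP lr => // ->; rewrite (negbTE pr).
Qed.

End AlternatingSum.

(** Characters of [A] trivial on [N] are the characters of [A / N], and an abelian group has as many
    of them as elements. *)
Lemma card_cfker_abelian (gT : finGroupType) (A N : {group gT}) :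
  abelian A -> N \subset A ->
  (#|[pred i : Iirr A | N \subset cfker ('chi_i)]| * #|N| = #|A|)%N.
Proof.
move=> abA sNA; have nNA : (N <| A)%g by rewrite -sub_abelian_normal.
have := on_card_preimset (mod_Iirr_bij nNA).
move=> <-.
have -> : (@mod_Iirr _ A N @^-1: [pred i | N \subset cfker 'chi_i])%g = [set: Iirr (A / N)].
  by apply/setP => i; rewrite !inE mod_IirrE // cfker_mod.
rewrite cardsT card_Iirr_abelian ?quotient_abelian // mulnC.
by rewrite card_quotient ?normal_norm // Lagrange.
Qed.

(** * Subgroups of a direct product given by orthogonal idempotent endomorphisms *)

Section GroupDensity.
Local Open Scope group_scope.
Variables (gT : finGroupType) (r : seq nat) (f : nat -> {morphism [set: gT] >-> gT}).
Hypothesis ur : uniq r.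
Hypothesis f_id : forall l x, l \in r -> f l (f l x) = f l x.
Hypothesis f_orth : forall l l' x, l \in r -> l' \in r -> l != l' -> f l (f l' x) = 1.
Hypothesis f_prod : forall x, x = \prod_(l <- r) f l x.
Variables G H : {group gT}.
Hypothesis HE : forall x, x \in H = all (fun l => f l x \in f l @* G) r.
Hypothesis GR : forall l x y, l \in r -> x \in G -> y \in G -> f l [~ x, y] \in G.

Definition kerset (X : {set gT}) (B : seq nat) : {set gT} :=
  [set x in X | all (fun l => f l x == 1) B].

Definition local_factor (l : nat) : {set gT} :=
  [set x in H | all (fun l' => (l' == l) || (f l' x == 1)) r].

Let fM l x y : f l (x * y) = f l x * f l y.
Proof. by rewrite morphM ?inE. Qed.

Lemma group_set_kerset (X : {group gT}) B : group_set (kerset X B).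
Proof.
apply/group_setP; split.
  by rewrite inE group1; apply/allP => l _; rewrite morph1.
move=> x y; rewrite !inE => /andP[Xx /allP fx] /andP[Xy /allP fy].
rewrite groupM //=; apply/allP => l lB.
by rewrite fM (eqP (fx l lB)) (eqP (fy l lB)) mulg1.
Qed.
Canonical kerset_group X B := Group (group_set_kerset X B).

Lemma sub_density_group : G \subset H.
Proof.
apply/subsetP => x Gx; rewrite HE; apply/allP => l lr.
by apply: mem_morphim; rewrite ?inE.
Qed.

(** Each component of $[x,y]$ depends only on the components of $x$ and $y$ there, which are also
    those of some $g,h\in G$. So it equals $f_\ell[g,h]$, an element of $G$ by [GR]. *)
Lemma der1_sub_density : H^`(1) \subset G.
Proof.
rewrite gen_subG; apply/subsetP => _ /imset2P[x y Hx Hy ->].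
rewrite [X in X \in _]f_prod big_seq; apply: group_prod => l lr.
rewrite !HE in Hx Hy.
have /morphimP[g _ Gg eg] := allP Hx l lr.
have /morphimP[h _ Gh eh] := allP Hy l lr.
by rewrite morphR ?inE // eg eh -morphR ?inE //; apply: GR.
Qed.

Lemma density_normal : G <| H.
Proof. exact: sub_der1_normal der1_sub_density sub_density_group. Qed.

Lemma density_abelian : abelian (H / G).
Proof. exact: sub_der1_abelian der1_sub_density. Qed.

(** The kernel of [f l] on [kerset X B] is [kerset X (l :: B)], so this is Lagrange's theorem. *)
Lemma card_kerset_cons (X : {group gT}) l B :
  (#|kerset X (l :: B)| * #|f l @* kerset X B| = #|kerset X B|)%N.
Proof.
rewrite card_morphim setTI -[RHS](LagrangeI _ ('ker (f l))); congr (_ * _)%N.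
apply: eq_card => x; rewrite !inE /=.
by rewrite -andbA; congr (_ && _); rewrite andbC.
Qed.

(** For $g\in G$ the element $f_\ell(g)$ already lies in the full product [H] and is trivial at
    every other prime, so imposing triviality on [B] costs nothing at [l]. *)
Lemma morphim_kerset l B : l \in r -> l \notin B -> {subset B <= r} ->
  f l @* kerset H B = f l @* G.
Proof.
move=> lr lB sB; apply/eqP; rewrite eqEsubset; apply/andP; split.
  apply/subsetP => _ /morphimP[x _ /setIdP[Hx _] ->].
  by rewrite HE in Hx; apply: (allP Hx).
apply/subsetP => _ /morphimP[g _ Gg ->].
rewrite -f_id //; apply: mem_morphim; rewrite ?inE // HE; apply/andP; split.
  apply/allP => l' l'r; have [->|n] := eqVneq l' l; first by rewrite f_id // mem_morphim ?inE.
  by rewrite f_orth // group1.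
apply/allP => l' l'B; rewrite f_orth // ?sB //.
by apply: contraNneq lB => <-.
Qed.

Lemma card_kerset B : uniq B -> {subset B <= r} ->
  (#|kerset H B| * \prod_(l <- B) #|f l @* G| = #|H|)%N.
Proof.
elim: B => [|l B IHB] /=.
  move=> _ _; rewrite big_nil muln1; apply: eq_card => x.
  by rewrite !inE andbT.
case/andP=> lB uB sB; have lr : l \in r by apply: sB; rewrite mem_head.
have sB' : {subset B <= r} by move=> x xB; apply: sB; rewrite inE xB orbT.
rewrite big_cons mulnA -(morphim_kerset lr lB sB') card_kerset_cons.
exact: IHB.
Qed.

(** By [f_prod], each element of [kerset H B] is a product of elements of the local factors at the
    primes outside [B]. *)
Lemma kerset_sub_cfker B (i : Iirr (H / G)) : {subset B <= r} ->
  (kerset H B / G \subset cfker 'chi_i) =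
  all (fun l => (l \in B) || (local_factor l \subset cfker ('chi_i %% G))) r.
Proof.
move=> sB; rewrite -(sub_cfker_mod _ density_normal); last first.
  apply: subset_trans (normal_norm density_normal).
  by apply/subsetP => x /setIdP[].
apply/idP/allP => [sK l lr | sF].
  case: (boolP (l \in B)) => //= lB; apply: subset_trans sK.
  apply/subsetP => x /setIdP[Hx /allP fx]; rewrite inE Hx.
  apply/allP => l' l'B; have := fx l' (sB _ l'B).
  by case: eqP l'B lB => // -> ->.
apply/subsetP => x /setIdP[Hx /allP fx]; rewrite [x]f_prod big_seq.
apply: group_prod => l lr; have [lB|lB] := boolP (l \in B).
  by rewrite (eqP (fx l lB)) group1.
have := sF l lr; rewrite (negbTE lB) /= => /subsetP; apply.
rewrite inE HE; apply/andP; split; apply/allP => l' l'r.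
  have [->|n] := eqVneq l' l; last by rewrite f_orth // group1.
  by rewrite f_id //; rewrite HE in Hx; apply: (allP Hx).
by have [//|n] := eqVneq l' l; rewrite f_orth ?eqxx.
Qed.

(** Write $K_B$ for [kerset H B]. The number of characters is $[H:K_BG]$, while
    $|K_BG/G|=|K_B|/|K_B\cap G|$, where $K_B\cap G$ is [kerset G B] and $|K_B|=|H|/\prod_{\ell\in
    B}|f_\ell(G)|$. *)
Lemma card_kerset_quotient B : uniq B -> {subset B <= r} ->
  (#|[pred i : Iirr (H / G) | (kerset H B / G)%g \subset cfker 'chi_i]| * #|G|
   = #|kerset G B| * \prod_(l <- B) #|f l @* G|)%N.
Proof.
move=> uB sB.
set c := #|[pred i : Iirr (H / G) | (kerset H B / G)%g \subset cfker 'chi_i]|.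
have nK : kerset H B \subset 'N(G).
  apply: subset_trans (normal_norm density_normal).
  by apply/subsetP => x /setIdP[].
have sK : kerset H B / G \subset H / G.
  by apply: quotientS; apply/subsetP => x /setIdP[].
have e1 : (c * #|kerset H B / G| = #|H / G|)%N.
  exact: card_cfker_abelian density_abelian sK.
have e2 := LagrangeI [group of kerset H B] G; rewrite /= -card_quotient // in e2.
have eG : #|kerset H B :&: G| = #|kerset G B|.
  apply: eq_card => x; rewrite !inE; case Gx: (x \in G); rewrite ?andbF ?andbT //=.
  by rewrite (subsetP sub_density_group).
have e3 : (#|G| * #|H / G| = #|H|)%N.
  by rewrite card_quotient ?normal_norm ?density_normal // Lagrange // sub_density_group.
have e4 := card_kerset uB sB.
have N0 : (0 < #|kerset H B / G|)%N by apply: (cardG_gt0 (kerset_group H B / G)).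
apply/eqP; rewrite -(eqn_pmul2r N0); apply/eqP.
transitivity (#|G| * (c * #|kerset H B / G|))%N.
  by rewrite -mulnA mulnCA.
by rewrite e1 e3 -e4 -e2 eG mulnAC.
Qed.

Local Open Scope ring_scope.

Lemma density_charsum B : uniq B -> {subset B <= r} ->
  (#|kerset G B|%:R / #|G|%:R : rat) =
  \sum_(i : Iirr (H / G)) \prod_(l <- r)
    (if l \in B then (#|f l @* G|%:R)^-1
     else (local_factor l \subset cfker ('chi_i %% G)%CF)%:R).
Proof.
move=> uB sB; have e := card_kerset_quotient uB sB.
have card0 (A : {group gT}) : #|A|%:R != 0 :> rat by rewrite pnatr_eq0 -lt0n cardG_gt0.
pose D : rat := \prod_(l <- B) #|f l @* G|%:R.
have D0 : D != 0.
  by apply: (big_ind (fun x : rat => x != 0)) => [|x y|l _];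
    [exact: oner_neq0 | exact: mulf_neq0 | exact: (card0 (f l @* G)%G)].
transitivity (#|[pred i : Iirr (H / G) | (kerset H B / G)%g \subset cfker 'chi_i]|%:R / D).
  apply: (canRL (mulfK D0)); rewrite mulrAC; apply: (canLR (mulfK (card0 G))).
  by rewrite /D -natr_prod -!natrM e.
rewrite -sum1_card natr_sum mulr_suml big_mkcond; apply: eq_bigr => i _.
rewrite inE kerset_sub_cfker // (bigID (mem B)) /=.
have -> : \prod_(l <- r | l \in B) (if l \in B then (#|f l @* G|%:R)^-1
     else (local_factor l \subset cfker ('chi_i %% G)%CF)%:R) = D^-1.
  rewrite -prodfV -big_filter.
  have pB : perm_eq [seq l <- r | l \in B] B.
    apply: uniq_perm; rewrite ?filter_uniq // => l.
    by rewrite mem_filter; case lB : (l \in B); rewrite // sB.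
  rewrite (perm_big _ pB) /= big_seq [RHS]big_seq.
  by apply: eq_bigr => l ->.
rewrite [RHS]mulrC; case: allP => [h | nh].
  congr (_ / D); apply/esym; rewrite big_seq_cond big1 // => l /andP[lr lB].
  by have := h l lr; rewrite (negbTE lB) /= => ->.
apply/esym/eqP; rewrite mulf_eq0; apply/orP; left; apply/negPn/negP => nz.
apply: nh => l lr; case lB : (l \in B) => //=.
rewrite (big_rem l lr) /= lB /= mulf_eq0 negb_or in nz.
by case/andP: nz; case: (_ \subset _); rewrite // eqxx.
Qed.

(** Guards the denominator $|G(\ell)|-1$: if $G(\ell)$ is trivial, every character is trivial on it
    and the other branch of $E_{\chi,\ell}$ is taken. *)
Lemma local_factor_sub1 l : l \in r -> #|f l @* G| = 1%N -> local_factor l \subset [1 gT]%g.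
Proof.
move=> lr /eqP; rewrite -trivg_card1 => /eqP fG; apply/subsetP => x /setIdP[Hx /allP fx].
rewrite [x]f_prod big_seq; apply: group_prod => l' l'r.
have := fx l' l'r; case: eqP => [->|_ /= /eqP ->]; last exact: group1.
by move=> _; rewrite HE in Hx; have := allP Hx l lr; rewrite fG.
Qed.

Lemma altsum_density :
  altsum r (fun B => #|kerset G B|%:R / #|G|%:R : rat) =
  (\prod_(l <- r) (1 - (#|f l @* G|%:R)^-1)) *
  \sum_(i : Iirr (H / G)) \prod_(l <- r)
    (if local_factor l \subset cfker ('chi_i %% G)%CF then 1
     else - 1 / (#|f l @* G|%:R - 1)).
Proof.
rewrite (@eq_altsum _ _ _ (fun B => \sum_(i : Iirr (H / G)) \prod_(l <- r)
    (if l \in B then (#|f l @* G|%:R)^-1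
     else (local_factor l \subset cfker ('chi_i %% G)%CF)%:R))); last first.
  move=> B sB; apply: density_charsum; first exact: subseq_uniq sB ur.
  exact: mem_subseq.
rewrite altsum_sum mulr_sumr; apply: eq_bigr => i _.
rewrite altsum_prod // -big_split /= big_seq [RHS]big_seq.
apply: eq_bigr => l lr; set d := #|_|.
have d0 : d%:R != 0 :> rat by rewrite pnatr_eq0 -lt0n (cardG_gt0 (f l @* G)).
case: ifP => [_|nF]; first by rewrite mulr1.
have d1 : d%:R - 1 != 0 :> rat.
  rewrite subr_eq0 (eqr_nat _ d 1); apply/negP => /eqP d1.
  by move/negP: nF; apply; apply: subset_trans (local_factor_sub1 lr d1) (sub1G _).
(* The identity is $-\frac1d=\left(1-\frac1d\right)\cdot\frac{-1}{d-1}$. *)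
by rewrite /= sub0r; field; rewrite d0 d1.
Qed.

End GroupDensity.

(** * Local components in GL_2(Z/m) *)

Lemma prod_primes_dvd (B : seq nat) k : uniq B -> all prime B ->
  (forall l, l \in B -> (l %| k)%N) -> (\prod_(l <- B) l %| k)%N.
Proof.
elim: B => [|p B IHB] /=; first by rewrite big_nil dvd1n.
case/andP=> pB uB /andP[pp aB] dB; rewrite big_cons Gauss_dvd.
  rewrite dB ?mem_head // IHB // => l lB; apply: dB; by rewrite inE lB orbT.
rewrite big_seq; apply: (big_ind (fun x => coprime p x)) => [|x y|l lB].
- exact: coprimen1.
- by rewrite coprimeMr => -> ->.
rewrite prime_coprime // dvdn_prime2 //; last exact: (allP aB).
by apply: contraNN pB => /eqP ->.
Qed.

Section Idempotents.
Variables (m : nat) (m_gt1 : (1 < m)%N).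
Hypothesis m_sqf : m = (\prod_(l <- primes m) l)%N.
Local Notation r := (primes m).
Local Notation gT := {'GL_2['Z_m]}.

Let all_prime_r : all prime r := all_prime_primes m.
Let r_dvd l : l \in r -> (l %| m)%N.
Proof. by rewrite mem_primes => /and3P[]. Qed.
Let r_prime l : l \in r -> prime l.
Proof. by rewrite mem_primes => /and3P[]. Qed.

Lemma Zp_sqf_inj (x y : 'Z_m) :
  (forall l, l \in r -> ((x : nat) = y %[mod l])%N) -> x = y.
Proof.
move=> h; apply: (Zp_val_inj m_gt1); apply/eqP.
wlog le : x y h / (y <= x)%N => [hw|].
  by case: (leqP y x) => [/(hw x y h) //|/ltnW le]; rewrite eq_sym hw // => l /h.
rewrite eqn_mod_dvd //; suff: (\prod_(l <- r) l %| x - y)%N by rewrite -m_sqf.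
apply: prod_primes_dvd => //; first exact: primes_uniq.
by move=> l lr; rewrite -eqn_mod_dvd //; apply/eqP; apply: h.
Qed.

Lemma coprime_cofactor l : l \in r -> coprime l (m %/ l).
Proof.
move=> lr; have pl := r_prime lr; rewrite prime_coprime //.
have -> : (m %/ l = \prod_(p <- rem l r) p)%N.
  have e : (l * \prod_(p <- rem l r) p = m)%N by rewrite [RHS]m_sqf (big_rem l lr).
  by rewrite -[X in (X %/ _)%N]e mulKn // prime_gt0.
have ul : l \notin rem l r by rewrite mem_rem_uniqF // primes_uniq.
have pr : all prime (rem l r) by apply/allP => p /mem_rem; apply: allP.
elim: (rem l r) ul pr => [|p s IHs]; first by rewrite big_nil dvdn1 => _ _; case: l pl {lr} => [|[]].
rewrite inE negb_or => /andP[lp ls] /= /andP[pp ps].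
by rewrite big_cons Euclid_dvdM // dvdn_prime2 // negb_or lp IHs.
Qed.

(** The idempotent cutting out the factor $\mathbb{Z}/\ell$ of $\mathbb{Z}/m$; it exists because
    $\ell$ and $m/\ell$ are coprime for square-free $m$. *)
Definition idem (l : nat) : 'Z_m := (chinese l (m %/ l) 1 0)%:R.

Lemma idem_mod l l' : l \in r -> l' \in r ->
  ((idem l : nat) = (l == l' : nat) %[mod l'])%N.
Proof.
move=> lr lr'; rewrite Zp_val_nat ?r_dvd //; have co := coprime_cofactor lr.
case: eqVneq => [<-|n]; first by rewrite chinese_modl.
have d : (l' %| m %/ l)%N.
  have : (l' %| m %/ l * l)%N by rewrite divnK r_dvd.
  by rewrite Euclid_dvdM ?r_prime // orbC dvdn_prime2 ?r_prime // eq_sym (negbTE n).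
by rewrite -(modn_dvdm _ d) chinese_modr // mod0n.
Qed.

Lemma idem_mul_mod l k (y : 'Z_m) : l \in r -> k \in r ->
  (((idem l * y)%R : nat) = (l == k) * y %[mod k])%N.
Proof.
by move=> lr kr; rewrite Zp_val_mul ?r_dvd // -modnMml idem_mod // modnMml.
Qed.

Lemma idemM l l' : l \in r -> l' \in r ->
  idem l * idem l' = if l == l' then idem l else 0.
Proof.
move=> lr lr'; apply: Zp_sqf_inj => k kr.
rewrite Zp_val_mul ?r_dvd // -modnMm !idem_mod // modnMm.
case: (eqVneq l l') => [<-|n].
  by rewrite idem_mod //; case: (l == k).
by case: (eqVneq l k) => [<-|]; rewrite ?mul0n // eq_sym (negbTE n) muln0.
Qed.

Lemma sum_idem : \sum_(l <- r) idem l = 1.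
Proof.
apply: Zp_sqf_inj => k kr.
have -> : (((\sum_(l <- r) idem l)%R : nat) = \sum_(l <- r) (idem l : nat) %[mod k])%N.
  elim: (r) => [|l s IHs]; first by rewrite !big_nil.
  by rewrite !big_cons Zp_val_add ?r_dvd // -modnDmr IHs modnDmr.
have -> : (\sum_(l <- r) (idem l : nat) = \sum_(l <- r) (l == k : nat) %[mod k])%N.
  rewrite [in LHS]big_seq [in RHS]big_seq.
  apply: (big_ind2 (fun x y => x = y %[mod k]))%N => // [x x' y y' ex ey|l lr].
    by rewrite -modnDm ex ey modnDm.
  exact: idem_mod.
rewrite (big_rem k) //= eqxx big1_seq ?addn0.
  by rewrite /= Zp_cast // (modn_small m_gt1).
move=> l /andP[_ ls]; case: eqP => // e; move: ls.
by rewrite e mem_rem_uniqF // primes_uniq.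
Qed.

(* [localmx l u] is congruent to u mod l and to 1 mod the other primes of m. *)
Definition localmx l (u : 'M['Z_m]_2) : 'M['Z_m]_2 := 1 + idem l *: (u - 1).

Lemma localmxM l u v : l \in r -> localmx l u * localmx l v = localmx l (u * v).
Proof.
move=> lr; rewrite /localmx; set a := u - 1; set c := v - 1.
have -> : u * v - 1 = a + c + a * c.
  rewrite -[u](subrK 1) -[v](subrK 1) -/a -/c mulrDl mulrDr mulr1 mul1r.
  by rewrite addrA addrK -addrA addrC.
rewrite mulrDl mul1r mulrDr mulr1 -scalerAl -scalerAr scalerA idemM // eqxx /=.
by clearbody a c; rewrite !scalerDr -!addrA; congr (_ + _); rewrite addrCA.
Qed.

Lemma localmx1 l : localmx l 1 = 1.
Proof. by rewrite /localmx subrr scaler0 addr0. Qed.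

Lemma localmx_unit l (u : gT) : l \in r -> localmx l (GLval u) \in unitmx.
Proof.
move=> lr; apply: (proj1 (mulmx1_unit (B := localmx l (GLval u^-1)) _)).
rewrite -[LHS]/(localmx l (GLval u) * localmx l (GLval u^-1)) localmxM //.
by rewrite -[X in localmx _ X]/(GLval (u * u^-1)%g) mulgV localmx1.
Qed.

(** The value 1 for [l] outside [r] makes [localGL l] a group morphism for every natural number [l],
    as the abstract section requires. *)
Fact localGL_subproof l (u : gT) :
  {v : gT | GLval v = if l \in r then localmx l (GLval u) else 1}.
Proof.
case: ifP => [lr|_]; last by exists 1%g.
by exists (insubd (1%g : gT) (localmx l (GLval u))); rewrite [LHS]insubdK //; apply: localmx_unit.
Qed.

Definition localGL l (u : gT) : gT := sval (localGL_subproof l u).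

Lemma GLval_local l u : l \in r -> GLval (localGL l u) = localmx l (GLval u).
Proof. by move=> lr; rewrite /localGL; case: localGL_subproof => v /= ->; rewrite lr. Qed.

Lemma GLval_inj (u v : gT) : GLval u = GLval v -> u = v.
Proof. exact: val_inj. Qed.

Lemma localGL_morph l : {in [set: gT] &, {morph localGL l : x y / (x * y)%g}}.
Proof.
move=> x y _ _; have [lr|lr] := boolP (l \in r); last first.
  have e z : localGL l z = 1%g.
    by apply: GLval_inj; rewrite /localGL; case: localGL_subproof => v /= ->; rewrite (negbTE lr).
  by rewrite !e mulg1.
by apply: GLval_inj; rewrite GLval_local // -localmxM // -!GLval_local.
Qed.

Canonical localGL_morphism l := Morphism (@localGL_morph l).

Lemma localGL_id l x : l \in r -> localGL l (localGL l x) = localGL l x.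
Proof.
move=> lr; apply: GLval_inj.
rewrite (GLval_local (localGL l x) lr) (GLval_local x lr) /localmx.
by rewrite [1 + _ - 1]addrC addKr scalerA idemM // eqxx.
Qed.

Lemma localGL_orth l l' x : l \in r -> l' \in r -> l != l' ->
  localGL l (localGL l' x) = 1%g.
Proof.
move=> lr lr' n; apply: GLval_inj; rewrite !GLval_local // /localmx.
by rewrite [1 + _ - 1]addrC addKr scalerA idemM // (negbTE n) scale0r addr0.
Qed.

Lemma localGL_prod x : x = (\prod_(l <- r) localGL l x)%g.
Proof.
(* Orthogonality of the idempotents removes the cross terms of every partial product; over all of
   [r] the idempotents sum to 1. *)
have H s : uniq s -> {subset s <= r} -> GLval (\prod_(l <- s) localGL l x)%g =
    1 + (\sum_(l <- s) idem l) *: (GLval x - 1).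
  elim: s => [|l s IHs] /=; first by rewrite !big_nil scale0r addr0.
  case/andP=> ls us sr; have lr := sr _ (mem_head _ _).
  have sr' : {subset s <= r} by move=> z zs; apply: sr; rewrite inE zs orbT.
  rewrite !big_cons -[LHS]/(GLval (localGL l x) * GLval (\prod_(l <- s) localGL l x)%g).
  rewrite GLval_local // IHs // /localmx mulrDl mul1r mulrDr mulr1.
  have e0 : idem l * \sum_(k <- s) idem k = 0.
    rewrite mulr_sumr big_seq big1 // => k ks.
    rewrite idemM //; last exact: sr'.
    by case: eqP ls => // ->; rewrite ks.
  rewrite -scalerAl -scalerAr scalerA e0.
  by rewrite scale0r addr0 scalerDl -addrA [_ *: _ + (_ *: _)]addrC.
apply: GLval_inj; rewrite H ?primes_uniq // sum_idem scale1r.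
by rewrite addrC subrK.
Qed.

Lemma localGL_congr l x y : l \in r ->
  localGL l x = localGL l y <-> mxcongr l (GLval x) (GLval y).
Proof.
move=> lr; split=> [e i j|c].
  have : localmx l (GLval x) i j = localmx l (GLval y) i j by rewrite -!GLval_local ?e.
  rewrite !mxE => /addrI e'.
  have {e'} : idem l * GLval x i j = idem l * GLval y i j.
    by move: e'; rewrite !mulrBr => /addIr.
  move: (GLval x i j) (GLval y i j) => s t est.
  have := idem_mul_mod s lr lr; rewrite est (idem_mul_mod t lr lr) eqxx !mul1n.
  by move=> ->.
apply: GLval_inj; rewrite (GLval_local x lr) (GLval_local y lr) /localmx.
congr (1 + _); apply/matrixP => i j; rewrite !mxE !mulrBr; congr (_ - _).
have := c i j; move: (GLval x i j) (GLval y i j) => s t est.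
apply: Zp_sqf_inj => k kr; rewrite (idem_mul_mod s lr kr) (idem_mul_mod t lr kr).
by case: eqP => [<-|]; rewrite ?mul1n ?mul0n.
Qed.

Lemma mxcongr_prod B (x y : gT) : uniq B -> {subset B <= r} ->
  mxcongr (\prod_(l <- B) l) (GLval x) (GLval y) <->
  forall l, l \in B -> mxcongr l (GLval x) (GLval y).
Proof.
move=> uB sB; split=> [c l lB i j|c i j].
  have d : (l %| \prod_(p <- B) p)%N by rewrite (big_rem l) //= dvdn_mulr.
  by rewrite -(modn_dvdm _ d) c modn_dvdm.
apply/eqP; move: (GLval x i j : nat) (GLval y i j : nat) (fun l lB => c l lB i j) => s t.
wlog le : s t / (t <= s)%N => [hw h|h].
  by case: (leqP t s) => [/hw //|/ltnW le]; [exact | rewrite eq_sym hw // => l /h].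
rewrite eqn_mod_dvd //; apply: prod_primes_dvd => //.
  by apply/allP => l /sB /r_prime.
by move=> l lB; rewrite -eqn_mod_dvd //; apply/eqP; apply: h.
Qed.

End Idempotents.

Lemma mxcongr_mull m d (w u v : 'M['Z_m]_2) : (1 < m)%N -> (d %| m)%N ->
  mxcongr d u v -> mxcongr d (w *m u) (w *m v).
Proof.
move=> m_gt1 dm c i j; rewrite !mxE.
elim/big_ind2 : _ => // [x x' y y' ex ey|k _].
  by rewrite !Zp_val_add // -modnDm ex ey modnDm.
by rewrite !Zp_val_mul // -modnMmr c modnMmr.
Qed.

(** * The matrix group of an action on the m-torsion *)

Section GaloisImage.
Variables (V : zmodType) (m : nat) (p q : V).
Hypothesis m_gt1 : (1 < m)%N.
Hypotheses (pm : p *+ m = 0) (qm : q *+ m = 0).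
Hypothesis basis : forall r, r *+ m = 0 -> exists! ij : nat * nat,
  [/\ (ij.1 < m)%N, (ij.2 < m)%N & r = p *+ ij.1 + q *+ ij.2].
Hypothesis m_sqf : m = (\prod_(l <- primes m) l)%N.
Local Notation r := (primes m).
Local Notation gT := {'GL_2['Z_m]}.

Variables (S : Type) (g : S -> {additive V -> V}).
Variables (mulS : S -> S -> S) (invS : S -> S) (oneS : S).
Hypothesis gM : forall s t x, g (mulS s t) x = g s (g t x).
Hypothesis g1 : forall x, g oneS x = x.
Hypothesis gV : forall s x, g s (g (invS s) x) = x.

Definition represents d s (u : gT) : Prop := mxrep p q d (g s) (GLval u).

Lemma represents_exists s : exists u, represents m s u.
Proof.
have [A hA] := mxrep_exists m_gt1 pm qm basis (g s).
have [A' hA'] := mxrep_exists m_gt1 pm qm basis (g (invS s)).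
have AA' : A *m A' = 1%:M.
  have h := mxrep_comp m_gt1 pm qm (dvdnn m) hA hA'.
  have h1 : mxrep p q m (g s \o g (invS s)) (1%:M : 'M['Z_m]_2).
    have [e1 e2] := mxrep_id p q m_gt1 m.
    by rewrite /mxrep /= !gV.
  apply/matrixP => i j; apply: (Zp_val_inj m_gt1).
  by apply: ((mxrep_congr m_gt1 pm qm basis _ (dvdnn m) h).1 h1).
have [UA _] := mulmx1_unit AA'.
by exists (insubd (1%g : gT) A); rewrite /represents [GLval _]insubdK.
Qed.

Lemma represents_mul d s t u v : (d %| m)%N ->
  represents d s u -> represents d t v -> represents d (mulS s t) (u * v)%g.
Proof.
move=> dm su tv; have := mxrep_comp m_gt1 pm qm dm su tv.
by rewrite /represents /mxrep /= !gM.
Qed.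

Lemma represents_one d : represents d oneS 1%g.
Proof. by have := mxrep_id p q m_gt1 d; rewrite /represents /mxrep /= !g1. Qed.

Lemma represents_dvd d s u : (d %| m)%N -> represents m s u -> represents d s u.
Proof. by move=> dm; apply: mxrep_dvd. Qed.

Lemma represents_eq_on d s t u v : (d %| m)%N ->
  represents d s u -> represents d t v ->
  (forall x, x *+ d = 0 -> g s x = g t x) <-> mxcongr d (GLval u) (GLval v).
Proof. by move=> dm su tv; apply: (mxrep_eq_on m_gt1 pm qm basis dm su tv). Qed.

Definition galset : {set gT} := [set u | `[< exists s, represents m s u >]].

Lemma group_set_galset : group_set galset.
Proof.
apply/group_setP; split.
  by rewrite inE; apply/asboolP; exists oneS; apply: represents_one.
move=> u v; rewrite !inE => /asboolP[s su] /asboolP[t tv].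
by apply/asboolP; exists (mulS s t); apply: represents_mul.
Qed.
Canonical galset_group := Group group_set_galset.

Lemma galsetP u : reflect (exists s, represents m s u) (u \in galset).
Proof. by rewrite inE; apply: asboolP. Qed.

Lemma mxcongr_mulVg d (u v : gT) : (d %| m)%N ->
  mxcongr d (GLval u) (GLval v) <-> mxcongr d (GLval (u^-1 * v)%g) (GLval (1%g : gT)).
Proof.
move=> dm; split=> c.
  have c' : mxcongr d (GLval (u^-1 * u)%g) (GLval (u^-1 * v)%g) :=
    mxcongr_mull (GLval u^-1) m_gt1 dm c.
  by move=> i j; rewrite -c' mulVg.
have c' : mxcongr d (GLval (u * (u^-1 * v))%g) (GLval (u * 1)%g) :=
  mxcongr_mull (GLval u) m_gt1 dm c.
by rewrite mulKVg mulg1 in c' => i j; rewrite c'.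
Qed.

(** Equal action on the [d]-torsion means congruent matrices mod [d], so the [k] actions partition
    the image into cosets of its congruence subgroup; the pairs (action, matrix) are counted in two
    ways. *)
Lemma card_galset d k (ss : 'I_k -> S) : (d %| m)%N ->
  (forall i j, i != j -> exists2 x, x *+ d = 0 & g (ss i) x <> g (ss j) x) ->
  (forall s, exists i, forall x, x *+ d = 0 -> g s x = g (ss i) x) ->
  (k * #|[set u in galset | `[< mxcongr d (GLval u) (GLval (1%g : gT)) >]]| = #|galset|)%N.
Proof.
move=> dm dist cover; set K := [set u in _ | _].
have /choice[v vP] : forall i, exists v, represents m (ss i) v.
  by move=> i; apply: represents_exists.
have vG i : v i \in galset by apply/galsetP; exists (ss i).
have cl i : #|[set u in galset | `[< mxcongr d (GLval (v i)) (GLval u) >]]| = #|K|.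
  rewrite -[RHS](card_lcoset _ (v i)); apply: eq_card => u.
  rewrite mem_lcoset; apply/setIdP/setIdP => -[uG /asboolP c]; split.
  - by rewrite groupM ?groupV.
  - by apply/asboolP; exact: (mxcongr_mulVg (v i) u dm).1 c.
  - by rewrite -(groupMl _ (groupVr (vG i))).
  - by apply/asboolP; exact: (mxcongr_mulVg (v i) u dm).2 c.
rewrite -[LHS]/(k * #|K|)%N -[RHS]sum1_card.
have split1 u : u \in galset ->
    (\sum_(i < k) (`[< mxcongr d (GLval (v i)) (GLval u) >] : nat) = 1)%N.
  case/galsetP=> s su; have [i0 e0] := cover s.
  rewrite (bigD1 i0) //= big1 ?addn0 => [|j nj].
    suff -> : `[< mxcongr d (GLval (v i0)) (GLval u) >] by [].
    apply/asboolP/(represents_eq_on dm (represents_dvd dm (vP i0)) (represents_dvd dm su)).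
    by move=> x xd; rewrite e0.
  case: asboolP => // /(represents_eq_on dm (represents_dvd dm (vP j)) (represents_dvd dm su)) e.
  by have [x xd []] := dist _ _ nj; rewrite e // e0.
rewrite (eq_bigr _ (fun u uG => esym (split1 u uG))) exchange_big /=.
rewrite -[k in LHS]card_ord -sum_nat_const; apply: eq_bigr => i _.
rewrite -(cl i) -sum1_card big_mkcond [RHS]big_mkcond; apply: eq_bigr => u _.
have -> : (u \in [set u in galset | `[< mxcongr d (GLval (v i)) (GLval u) >]]) =
    (u \in galset) && `[< mxcongr d (GLval (v i)) (GLval u) >].
  by apply/setIdP/andP.
by case: (u \in galset); case: asboolP.
Qed.

Lemma galset_kerset B : uniq B -> {subset B <= r} ->
  kerset (fun l => localGL_morphism m_gt1 m_sqf l) galset B =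
  [set u in galset | `[< mxcongr (\prod_(l <- B) l) (GLval u) (GLval (1%g : gT)) >]].
Proof.
move=> uB sB; apply/setP => u; apply/setIdP/setIdP => -[uG hu]; split=> //.
  apply/asboolP; move/allP: hu => h.
  apply/(mxcongr_prod _ _ uB sB) => l lB.
  apply/(localGL_congr m_gt1 m_sqf _ _ (sB _ lB)).
  by rewrite (morph1 (localGL_morphism m_gt1 m_sqf l)); apply/eqP; apply: h.
move/asboolP/(mxcongr_prod _ _ uB sB): hu => h; apply/allP => l lB; apply/eqP.
have /= := (localGL_congr m_gt1 m_sqf _ _ (sB _ lB)).2 (h l lB).
by rewrite (morph1 (localGL_morphism m_gt1 m_sqf l)) => ->.
Qed.

(** The element [x] supplied by the entanglement acts as the commutator on the [l]-torsion and
    trivially on the [m/l]-torsion. Its matrix is therefore the [l]-component of $[u,v]$, which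
    places that component in the image. *)
Lemma galset_local_comm l u v : l \in r ->
  (forall s t, exists x, (forall z, z *+ (m %/ l)%N = 0 -> g x z = z) /\
    (forall z, z *+ l = 0 -> g s (g t z) = g t (g s (g x z)))) ->
  u \in galset -> v \in galset -> localGL m_gt1 m_sqf l [~ u, v]%g \in galset.
Proof.
move=> lr ent /galsetP[s su] /galsetP[t tv].
have [x [x1 x2]] := ent s t; have [w xw] := represents_exists x.
have dvd k : k \in r -> (k %| m)%N by rewrite mem_primes => /and3P[].
have lm := dvd l lr.
suff -> : localGL m_gt1 m_sqf l [~ u, v]%g = w by apply/galsetP; exists x.
have -> : localGL m_gt1 m_sqf l [~ u, v]%g = localGL m_gt1 m_sqf l w.
  apply/(localGL_congr m_gt1 m_sqf _ _ lr).
  have h : mxcongr l (GLval (u * v)%g) (GLval (v * u * w)%g).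
    apply/(represents_eq_on lm (s := mulS s t) (t := mulS (mulS t s) x)).
    - by apply: represents_mul => //; apply: represents_dvd.
    - by do 2?[apply: represents_mul => //]; apply: represents_dvd.
    - by move=> z zl; rewrite !gM x2.
  have h' : mxcongr l (GLval ((v * u)^-1 * (u * v))%g)
      (GLval ((v * u)^-1 * (v * u * w))%g) :=
    mxcongr_mull (GLval (v * u)^-1%g) m_gt1 lm h.
  by rewrite mulKg in h'; rewrite commgEl conjgE !mulgA -invMg -mulgA.
suff F1 k : k \in r -> k != l -> localGL m_gt1 m_sqf k w = 1%g.
  rewrite [RHS](localGL_prod m_gt1 m_sqf).
  rewrite (eq_big_seq (fun k => if k == l then localGL m_gt1 m_sqf k w else 1%g)).
    by rewrite -big_mkcond -big_filter filter_pred1_uniq ?primes_uniq // big_seq1.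
  by move=> k kr; case: eqVneq => // n; apply: F1.
move=> kr kl.
rewrite -(morph1 (localGL_morphism m_gt1 m_sqf k)); apply/(localGL_congr m_gt1 m_sqf _ _ kr).
have km := dvd k kr.
apply/(represents_eq_on km (represents_dvd km xw) (represents_one k)) => z zk.
have pk : prime k by move: kr; rewrite mem_primes => /and3P[].
have pl : prime l by move: lr; rewrite mem_primes => /and3P[].
have : (k %| m %/ l)%N.
  have : (k %| m %/ l * l)%N by rewrite divnK.
  by rewrite Euclid_dvdM // [X in _ || X]dvdn_prime2 // (negbTE kl) orbF.
by rewrite g1; case/dvdnP => c e; apply: x1; rewrite e mulnC mulrnA zk mul0rn.
Qed.

End GaloisImage.

(** * The finite level *)

Lemma sqf_rad_gt0 n : (0 < sqf_rad n)%N.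
Proof.
rewrite /sqf_rad big_seq; apply: prodn_cond_gt0 => p.
by rewrite mem_primes => /and3P[/prime_gt0].
Qed.

Lemma primes_sqf_rad n : primes (sqf_rad n) = primes n.
Proof.
apply: (irr_sorted_eq ltn_trans ltnn); rewrite ?sorted_primes // => p.
rewrite mem_primes sqf_rad_gt0 /= /sqf_rad.
have [pp|np] /= := boolP (prime p); last first.
  by symmetry; apply: contraNF np; rewrite mem_primes => /and3P[].
have : all prime (primes n) by apply: all_prime_primes.
elim: (primes n) => [|l s IHs]; first by rewrite big_nil dvdn1 => _; case: p pp => [|[]].
by case/andP=> pl ps; rewrite big_cons Euclid_dvdM // dvdn_prime2 // inE IHs.
Qed.

Lemma sqf_rad_prod n : sqf_rad n = (\prod_(l <- primes (sqf_rad n)) l)%N.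
Proof. by rewrite primes_sqf_rad. Qed.

Local Notation aut := {rmorphism algC -> algC}.

Section FiniteLevel.
Variables (a b : rat) (ns : nonsingular a b) (mE : nat) (P Q : point) (deg : nat -> nat).
Let m := sqf_rad mE.
Let r := primes m.
Hypothesis m_gt1 : (1 < m)%N.
Hypothesis ent : abelian_entanglements a b mE.
Hypothesis PQ : tors_basis a b m P Q.
Hypothesis degE : forall n, (0 < n)%N -> field_deg (QE a b n) (deg n).
Let m_sqf : m = (\prod_(l <- primes m) l)%N := sqf_rad_prod mE.
Local Notation E := (ecpoint ns).

Definition compA (s t : aut) : aut := (s \o t : aut).
(** Ring endomorphisms of $\overline{\mathbb{Q}}$ are bijective, so inverses exist although only
    morphisms are given. *)
Definition invA (s : aut) : aut := (algC_invaut s : aut).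
Definition oneA : aut := (idfun : aut).

Lemma galE_M s t (x : E) : galE (compA s t) x = galE s (galE t x).
Proof. exact: galE_comp. Qed.
Lemma galE_1 (x : E) : galE oneA x = x.
Proof. exact: galE_id. Qed.
Lemma galE_V s (x : E) : galE s (galE (invA s) x) = x.
Proof.
by apply: sval_inj => /=; case: (sval x) => [[u v]|] //=; rewrite !algC_invautK.
Qed.

Lemma gact_galE (s t : aut) n :
  (forall R, tors a b n R -> gact s R = gact t R) <->
  (forall x : E, x *+ n = 0 -> galE s x = galE t x).
Proof.
split=> [h x xn|h R /(tors_ec ns)[x <- xn]].
  by apply: sval_inj; apply: h; rewrite torsE xn.
by have /(congr1 sval) := h x xn.
Qed.

(** The hypothesis concerns the prime-power levels of $m_E$; it descends to the square-free level
    because $E[\ell]\subseteq E[\ell^\alpha]$, and likewise for the product of the other primes. *)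
Lemma local_entanglement l (s t : aut) : l \in r -> exists x : aut,
  (forall z : E, z *+ (m %/ l)%N = 0 -> galE x z = z) /\
  (forall z : E, z *+ l = 0 -> galE s (galE t z) = galE t (galE s (galE x z))).
Proof.
move=> lr; have lE : l \in primes mE by rewrite -primes_sqf_rad.
have pl : prime l by move: lE; rewrite mem_primes => /and3P[].
have lm : (l %| m)%N by move: lr; rewrite mem_primes => /and3P[].
have [hC|nC] := boolP (has (predC (pred1 l)) (primes mE)).
  have hA : has (pred1 l) (primes mE) by apply/hasP; exists l => //=.
  have [x [x1 x2]] := ent hA hC s t; exists x; split=> z zn.
    apply: sval_inj; apply: x1; rewrite torsE; apply/eqP.
    suff /dvdnP[c ->] : (m %/ l %| ppart mE (predC (pred1 l)))%N.
      by rewrite mulnC mulrnA zn mul0rn.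
    have e : (l * \prod_(p <- primes mE | p != l) p = m)%N.
      by rewrite /m /sqf_rad [RHS](bigD1_seq l) ?primes_uniq.
    rewrite -e mulKn ?prime_gt0 // /ppart big_seq_cond [X in (_ %| X)%N]big_seq_cond.
    apply: (big_ind2 (fun u v => u %| v)%N) => // [u u' v v'|p /andP[pE _]].
      exact: dvdn_mul.
    by rewrite dvdn_exp // logn_gt0.
  apply: sval_inj; apply: x2; rewrite torsE; apply/eqP.
  suff /dvdnP[c ->] : (l %| ppart mE (pred1 l))%N.
    by rewrite mulnC mulrnA zn mul0rn.
  rewrite /ppart (big_rem l) //= eqxx; apply: dvdn_mulr.
  by rewrite dvdn_exp // logn_gt0.
(* With a single prime there is no partition, but then $m/\ell=1$, triviality on $E[1]$ is
   automatic, and $(ts)^{-1}st$ serves as [x]. *)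
have ml : m = l.
  rewrite /m /sqf_rad (bigD1_seq l) ?primes_uniq //= big_seq_cond big1 ?muln1 //.
  move=> p /andP[pE pl']; move/hasPn: nC => /(_ p pE) /=.
  by rewrite pl'.
exists (compA (invA (compA t s)) (compA s t)); split=> z.
  by rewrite {1}ml divnn prime_gt0 // mulr1n => ->; rewrite raddf0.
by move=> _; rewrite -!galE_M -(galE_V (compA t s) (galE (compA s t) z)) !galE_M.
Qed.

Section Basis.
Variables p q : E.
Hypotheses (pP : sval p = P) (qQ : sval q = Q).

Lemma basisP : p *+ m = 0. Proof. by case: PQ; rewrite -pP torsE => /eqP. Qed.
Lemma basisQ : q *+ m = 0. Proof. by case: PQ => _; rewrite -qQ torsE => /eqP. Qed.

Lemma basis_ec (R : E) : R *+ m = 0 -> exists! ij : nat * nat,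
  [/\ (ij.1 < m)%N, (ij.2 < m)%N & R = p *+ ij.1 + q *+ ij.2].
Proof.
move/eqP; rewrite -torsE => tR; case: PQ => _ _ /(_ _ tR) [ij [[i1 i2 i3] u]].
have eqv (kl : nat * nat) : (sval R = padd a (pmuln a kl.1 P) (pmuln a kl.2 Q)) <->
    (R = p *+ kl.1 + q *+ kl.2).
  rewrite -pP -qQ -!sval_ecMn -sval_ecD.
  by split=> [/sval_inj|->].
exists ij; split; first by split=> //; apply/eqv.
by move=> kl [k1 k2 /eqv k3]; apply: u.
Qed.

Lemma galmat_atE l s (u : 'M['Z_m]_2) :
  galmat_at a m l P Q s u <-> mxrep p q l (galE s) u.
Proof.
rewrite /galmat_at /mxrep /tmul -pP -qQ -!sval_ecMn.
split=> -[e1 e2]; split.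
- by apply: sval_inj; rewrite /= e1 !sval_ecMn.
- by apply: sval_inj; rewrite /= e2 !sval_ecMn.
- by move/(congr1 sval): e1 => /= ->; rewrite !sval_ecMn.
- by move/(congr1 sval): e2 => /= ->; rewrite !sval_ecMn.
Qed.

Let gA (s : aut) : {additive E -> E} := galE s.
Local Notation gset := (galset m p q gA).
Local Notation pi l := (localGL_morphism m_gt1 m_sqf l).

Lemma Gm_setE : Gm_set a m P Q = gset.
Proof.
apply/setP => u; rewrite [LHS]in_set; apply/asboolP/galsetP.
  by case=> s /galmat_atE h; exists s.
by case=> s h; exists s; apply/galmat_atE.
Qed.

Let gset_group := galset_group m_gt1 basisP basisQ galE_M galE_1.

Lemma GmE : Gm a m P Q = gset :> {set _}.
Proof. by rewrite /Gm /= Gm_setE (genGid gset_group). Qed.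

Let r_dvd l : l \in r -> (l %| m)%N.
Proof. by rewrite mem_primes => /and3P[]. Qed.

Lemma galset_at l u : l \in r ->
  (pi l u \in pi l @* gset)%g <-> exists s, galmat_at a m l P Q s (GLval u).
Proof.
move=> lr; have lm := r_dvd lr; split.
  case/morphimP=> v _ /galsetP[s sv] /(localGL_congr m_gt1 m_sqf _ _ lr) uv.
  exists s; apply/galmat_atE.
  have sl := represents_dvd (g := gA) m_gt1 lm sv.
  apply: (mxrep_congr m_gt1 basisP basisQ basis_ec _ lm sl).2 => i j.
  by rewrite uv.
case=> s /galmat_atE su; have [v sv] := represents_exists m_gt1 basisP basisQ basis_ec (g := gA) galE_V s.
have sl := represents_dvd (g := gA) m_gt1 lm sv.
have vu := (mxrep_congr m_gt1 basisP basisQ basis_ec _ lm sl).1 su.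
have -> : pi l u = pi l v by apply/(localGL_congr m_gt1 m_sqf _ _ lr) => i j; rewrite vu.
by apply: mem_morphim; [rewrite inE | apply/galsetP; exists s].
Qed.

Lemma Gprod_setE u :
  (u \in Gprod_set a m P Q) = all (fun l => pi l u \in pi l @* gset)%g r.
Proof.
rewrite in_set; apply/asboolP/allP => [h l lr|h l pl lm].
  by apply/(galset_at _ lr); apply: h; move: lr; rewrite mem_primes => /and3P[].
have lr : l \in r by rewrite mem_primes pl lm sqf_rad_gt0.
by apply/(galset_at _ lr); apply: h.
Qed.

Lemma mem_Gprod u :
  (u \in Gprod a m P Q) = all (fun l => pi l u \in pi l @* Gm a m P Q)%g r.
Proof.
have gs : group_set (Gprod_set a m P Q).
  apply/group_setP; split.
    by rewrite Gprod_setE; apply/allP => l _; rewrite morph1 (group1 (pi l @* gset_group)).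
  move=> x y; rewrite !Gprod_setE => /allP hx /allP hy; apply/allP => l lr.
  by rewrite morphM ?inE // (groupM (G := (pi l @* gset_group)%G)) ?hx ?hy.
by rewrite /Gprod /= (genGid (Group gs)) Gprod_setE GmE.
Qed.

Lemma mem_Gfactor l : l \in r ->
  Gfactor_set a m l P Q = local_factor r (fun l => pi l) (Gprod a m P Q) l.
Proof.
move=> lr; have GP u : (u \in Gprod_set a m P Q) = (u \in Gprod a m P Q).
  by rewrite mem_Gprod GmE Gprod_setE.
apply/setP => u; apply/setIdP/setIdP => -[uG hu]; split; rewrite ?GP -?GP // in uG *.
  apply/allP => k kr; move/asboolP: hu => h.
  have /and3P[pk _ km] : [&& prime k, (0 < m)%N & (k %| m)%N] by rewrite -mem_primes.
  case: eqVneq => //= kl; apply/eqP.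
  rewrite -(morph1 (pi k)); apply/(localGL_congr m_gt1 m_sqf _ _ kr) => i j.
  rewrite (h k pk km) //; last by apply/eqP.
  by rewrite mxE (_ : ((_ *+ _) : 'Z_m) = (i == j)%:R) // Zp_val_nat.
apply/asboolP => k pk km kl i j; have kr : k \in r by rewrite mem_primes pk km sqf_rad_gt0.
move/allP: hu => /(_ k kr); case: eqP => //= _ /eqP.
rewrite -(morph1 (pi k)) => /(localGL_congr m_gt1 m_sqf _ _ kr) ->.
by rewrite mxE (_ : ((_ *+ _) : 'Z_m) = (i == j)%:R) // Zp_val_nat.
Qed.

Lemma card_Gm d : (d %| m)%N ->
  (deg d * #|[set u in gset | `[< mxcongr d (GLval u) (GLval (1%g : {'GL_2['Z_m]})) >]]|
   = #|gset|)%N.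
Proof.
move=> dm; have d_gt0 : (0 < d)%N by apply: dvdn_gt0 dm; apply: sqf_rad_gt0.
have [s [szs dist cover]] := field_deg_gal_card (degE d_gt0).
have nthE i : (i < deg d)%N -> nth idfun [seq (fun x => (f : aut) x) | f <- s] i = nth oneA s i.
  by move=> id; rewrite (nth_map oneA) ?szs.
apply: (@card_galset _ _ _ _ m_gt1 basisP basisQ basis_ec _ gA _ _ _ galE_M galE_1 galE_V _ _
   (fun i : 'I_(deg d) => nth oneA s i)) => //.
  move=> i j ij; have [|R [tR nR]] := dist i j (ltn_ord i) (ltn_ord j).
    by move=> e; move/eqP: ij; apply; apply: val_inj.
  have [x xR xd] := tors_ec ns tR; exists x => // e; apply: nR.
  by rewrite !nthE // -xR; move/(congr1 sval): e.
move=> t; have [i [id h]] := cover t; exists (Ordinal id).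
by apply/(gact_galE _ _ d) => R tR; rewrite h // nthE.
Qed.

Lemma density_Gm B : uniq B -> {subset B <= r} ->
  #|kerset (fun l => pi l) (Gm a m P Q) B|%:R / #|Gm a m P Q|%:R
  = (deg (\prod_(l <- B) l))%:R^-1 :> rat.
Proof.
move=> uB sB; rewrite GmE galset_kerset //.
have dm : (\prod_(l <- B) l %| m)%N.
  apply: prod_primes_dvd => // [|l lB]; last by apply: r_dvd; apply: sB.
  by apply/allP => l /sB; rewrite mem_primes => /and3P[].
have e := card_Gm dm; have := cardG_gt0 gset_group; rewrite /= -e muln_gt0.
case/andP=> d0 k0; rewrite natrM invfM mulrA mulrAC divff ?mul1r //.
by rewrite pnatr_eq0 -lt0n.
Qed.

(** Both numbers are the index in $G(m)$ of the elements that are 1 mod [l]: one by Lagrange, the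
    other by [density_Gm]. *)
Lemma card_local l : l \in r -> #|(pi l @* Gm a m P Q)%g| = deg l.
Proof.
move=> lr; have := card_kerset_cons (fun l => pi l) (Gm a m P Q) l [::].
have -> : kerset (fun l => pi l) (Gm a m P Q) [::] = Gm a m P Q.
  by apply/setP => u; apply/setIdP/idP => [[]|].
have sB : {subset [:: l] <= r} by move=> k; rewrite inE => /eqP->.
have := density_Gm (B := [:: l]) isT sB; rewrite big_seq1; set x := #|_|; set y := #|_| => e e2.
have y0 : (y%:R : rat) != 0 by rewrite pnatr_eq0 -lt0n (cardG_gt0 (Gm a m P Q)).
have x0 : (x%:R : rat) != 0.
  by apply: contraNneq y0 => x0; rewrite -e2 natrM x0 mul0r.
have : x%:R * (#|(pi l @* Gm a m P Q)%g|%:R : rat) = x%:R * (deg l)%:R.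
  rewrite -natrM e2 -[(deg l)%:R]invrK -e invf_div.
  by rewrite mulrCA divff // mulr1.
by move/(mulfI x0)/eqP; rewrite eqr_nat => /eqP.
Qed.

Lemma Gm_comm l x y : l \in r -> x \in Gm a m P Q -> y \in Gm a m P Q ->
  pi l [~ x, y]%g \in Gm a m P Q.
Proof.
move=> lr; rewrite GmE => xG yG.
apply: (galset_local_comm m_gt1 basisP basisQ basis_ec m_sqf galE_M galE_1 galE_V lr _ xG yG).
by move=> s t; apply: local_entanglement.
Qed.

Lemma altsum_deg :
  altsum r (fun B => ((deg (\prod_(l <- B) l))%:R^-1 : rat)) =
  (\prod_(l <- r) (1 - (deg l)%:R^-1)) * frakC a m P Q deg.
Proof.
have f_id l x : l \in r -> pi l (pi l x) = pi l x by move=> lr; apply: localGL_id.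
have f_orth l l' x : l \in r -> l' \in r -> l != l' -> pi l (pi l' x) = 1%g.
  by move=> lr lr' n; apply: localGL_orth.
have f_prod x : x = (\prod_(l <- r) pi l x)%g by apply: localGL_prod.
have main := altsum_density (primes_uniq m) f_id f_orth f_prod mem_Gprod Gm_comm.
rewrite (eq_altsum (h := fun B => #|kerset (fun l => pi l) (Gm a m P Q) B|%:R / #|Gm a m P Q|%:R)); last first.
  move=> B sB; rewrite density_Gm //; first exact: subseq_uniq sB (primes_uniq m).
  exact: mem_subseq.
rewrite main; congr (_ * _).
  by rewrite big_seq [RHS]big_seq; apply: eq_bigr => l lr; rewrite card_local.
have nG : (Gm a m P Q <| Gprod a m P Q)%g.
  by have := density_normal f_prod mem_Gprod Gm_comm.
have abG : abelian (Gprod a m P Q / Gm a m P Q)%g.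
  by have := density_abelian f_prod mem_Gprod Gm_comm.
(* The principal character contributes the leading 1 of [frakC]; since the quotient is abelian, the
   restriction to linear characters there excludes nothing. *)
rewrite /frakC leqNgt m_gt1 /= (bigD1 0) //=; congr (_ + _).
  rewrite big1_seq // => l /andP[_ lr].
  rewrite irr0 cfMod_cfun1 // cfker_cfun1 ifT //.
  by apply/subsetP => x /setIdP[].
apply: eq_big => [i|i _].
  by rewrite (char_abelianP _ abG) andbT.
rewrite big_seq [RHS]big_seq; apply: eq_bigr => l lr.
by rewrite /Echi mem_Gfactor // card_local.
Qed.

End Basis.

Lemma altsum_deg_frakC :
  altsum r (fun B => ((deg (\prod_(l <- B) l))%:R^-1 : rat)) =
  (\prod_(l <- r) (1 - (deg l)%:R^-1)) * frakC a m P Q deg.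
Proof.
have [tP tQ _] := PQ.
have [p pP _] := tors_ec ns tP; have [q qQ _] := tors_ec ns tQ.
exact: altsum_deg pP qQ.
Qed.

End FiniteLevel.

(** * The Euler product *)

Fixpoint sublists (T : Type) (r : seq T) : seq (seq T) :=
  if r is p :: r' then sublists r' ++ [seq p :: B | B <- sublists r'] else [:: [::]].

Lemma mem_sublists (T : eqType) (r B : seq T) : (B \in sublists r) = subseq B r.
Proof.
elim: r B => [|p r IHr] [|x B] //=; first by rewrite mem_cat IHr sub0seq.
rewrite mem_cat IHr; case: eqVneq => [->|n].
  rewrite mem_map => [|? ? [] //]; rewrite IHr orb_idl // => /(subseq_trans _); apply.
  exact: subseq_cons.
by rewrite orb_idr // => /mapP[B' _ [e _]]; rewrite e eqxx in n.
Qed.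

Lemma sublists_uniq (T : eqType) (r : seq T) : uniq r -> uniq (sublists r).
Proof.
elim: r => [|p r IHr] //= /andP[pr ur]; rewrite cat_uniq IHr // map_inj_uniq => [|? ? [] //].
rewrite IHr // andbT; apply/hasPn => _ /mapP[B _ ->] /=; rewrite mem_sublists.
by apply: contra pr => /mem_subseq; apply; rewrite mem_head.
Qed.

Lemma altsum_sublists (F : comPzRingType) r (g : seq nat -> F) :
  altsum r g = \sum_(B <- sublists r) (-1) ^+ size B * g B.
Proof.
elim: r g => [|p r IHr] g /=; first by rewrite big_seq1 mul1r.
rewrite !IHr big_cat big_map /= -sumrN; congr (_ + _).
by apply: eq_bigr => B _; rewrite exprS mulN1r mulNr.
Qed.

Lemma altsum_rmorph (F F' : comPzRingType) (h : {rmorphism F -> F'}) r g :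
  h (altsum r g) = altsum r (fun B => h (g B)).
Proof. by elim: r g => [|p r IHr] g //=; rewrite rmorphB !IHr. Qed.

Lemma altsum_prod_mem (F : comPzRingType) r (x : nat -> F) :
  altsum r (fun B => \prod_(l <- B) x l) = \prod_(l <- r) (1 - x l).
Proof.
elim: r => [|p r IHr] /=; first by rewrite !big_nil.
rewrite big_cons mulrBl mul1r -IHr -altsumZ; congr (_ - _).
by apply: eq_altsum => B _; rewrite big_cons.
Qed.

Section PrimeProducts.
Variable B : seq nat.
Hypotheses (uB : uniq B) (pB : all prime B).

Lemma prod_primes_gt0 : (0 < \prod_(l <- B) l)%N.
Proof. by rewrite big_seq; apply: prodn_cond_gt0 => l /(allP pB)/prime_gt0. Qed.

Lemma mem_primes_prod p : (p \in primes (\prod_(l <- B) l)) = (p \in B).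
Proof.
rewrite mem_primes prod_primes_gt0 /=.
have [pp|np] /= := boolP (prime p); last by apply/esym; apply: contraNF np => /(allP pB).
elim: (B) pB => [|l s IHs]; first by rewrite big_nil dvdn1 => _; case: p pp => [|[]].
by case/andP=> pl ps; rewrite big_cons Euclid_dvdM // dvdn_prime2 // inE IHs.
Qed.

Lemma perm_primes_prod : perm_eq (primes (\prod_(l <- B) l)) B.
Proof. by apply: uniq_perm; [exact: primes_uniq| |exact: mem_primes_prod]. Qed.

Lemma logn_prod_primes p : p \in B -> logn p (\prod_(l <- B) l) = 1%N.
Proof.
move=> pB'; have pp := allP pB p pB'; rewrite (big_rem p) //=.
have pr : all prime (rem p B) by apply/allP => l /mem_rem; apply: (allP pB).
have pos : (0 < \prod_(l <- rem p B) l)%N.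
  by rewrite big_seq; apply: prodn_cond_gt0 => l /(allP pr)/prime_gt0.
rewrite lognM // ?prime_gt0 // logn_prime // eqxx lognE pp pos /=.
case: ifP => // d; suff : p \in rem p B by rewrite mem_rem_uniqF.
elim: (rem p B) d pr {pos} => [|l s IHs]; first by rewrite big_nil dvdn1; case: p pp {pB'} => [|[]].
rewrite big_cons Euclid_dvdM // => d /andP[pl ps]; move: d.
by rewrite dvdn_prime2 // inE => /orP[->//|/IHs ->]; rewrite ?orbT.
Qed.

Lemma moebius_prod : moebius (\prod_(l <- B) l) = (-1) ^+ size B.
Proof.
rewrite /moebius prod_primes_gt0 (perm_size perm_primes_prod) ifT //=.
by apply/allP => p; rewrite mem_primes_prod => /logn_prod_primes ->.
Qed.

Lemma gl2_card_prod :
  gl2_card (\prod_(l <- B) l) = (\prod_(l <- B) ((l ^ 2 - 1) * (l ^ 2 - l)))%N.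
Proof.
rewrite /gl2_card (perm_big _ perm_primes_prod) /= big_seq [RHS]big_seq.
by apply: eq_bigr => p pB'; rewrite logn_prod_primes // muln0 mul1n.
Qed.

End PrimeProducts.

Lemma moebius_neq0 n : moebius n != 0 -> (0 < n)%N /\ n = (\prod_(l <- primes n) l)%N.
Proof.
rewrite /moebius; case: ifP; last by rewrite eqxx.
case/andP=> n0 /allP h _; split=> //.
rewrite {1}(prod_prime_decomp n0) prime_decompE big_map big_seq [RHS]big_seq.
by apply: eq_bigr => p /h /eqP /= ->; rewrite expn1.
Qed.

(** A crude bound for $|\mathrm{GL}_2(\mathbb{F}_\ell)|$, whose true size is about $\ell^4$; an
    exponent above 1 is enough for absolute convergence. *)
Lemma gl2_prime_ge l : (1 < l)%N -> (l ^ 2 <= (l ^ 2 - 1) * (l ^ 2 - l))%N.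
Proof.
move=> l1; have e1 : (l ^ 2 - l = l * (l - 1))%N by rewrite mulnBr muln1.
have e2 : (l ^ 2 - 1 = (l - 1) * (l + 1))%N.
  by rewrite -[X in (_ - X)%N](exp1n 2) subn_sqr.
have d0 : (0 < l - 1)%N by rewrite subn_gt0.
rewrite e1 e2 -mulnn mulnCA leq_mul2l; apply/orP; right.
rewrite mulnAC; apply: (@leq_trans (l + 1)); first exact: leq_addr.
by apply: leq_pmull; rewrite muln_gt0 d0.
Qed.

Local Open Scope classical_set_scope.
Local Open Scope ring_scope.

Section EulerProduct.
Variables (R : realType) (deg : nat -> nat) (mE : nat) (C : rat).
Hypothesis mE_gt0 : (0 < mE)%N.
Hypothesis deg_gt0 : forall n, (0 < n)%N -> (0 < deg n)%N.
Hypothesis deg1 : deg 1 = 1%N.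
Hypothesis degM : forall n1 n2, (0 < n1)%N -> (0 < n2)%N ->
  primes_dvd n1 mE -> coprime n2 mE -> deg (n1 * n2) = (deg n1 * gl2_card n2)%N.
Hypothesis altC : altsum (primes mE) (fun B => ((deg (\prod_(l <- B) l))%:R^-1 : rat))
  = (\prod_(l <- primes mE) (1 - (deg l)%:R^-1)) * C.

Let f (n : nat) : R := (moebius n)%:~R / (deg n)%:R.
Let pN (N : nat) : R := \prod_(0 <= l < N | prime l) (1 - ((deg l)%:R : R)^-1).
Let rest (N : nat) := [seq l <- index_iota 0 N | prime l && ~~ (l %| mE)%N].
Let rN (N : nat) := primes mE ++ rest N.
Let c (l : nat) := ((l ^ 2 - 1) * (l ^ 2 - l))%N.

Lemma deg_split_prod B1 B2 : uniq B1 -> {subset B1 <= primes mE} ->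
  uniq B2 -> all (fun l => prime l && ~~ (l %| mE)%N) B2 ->
  deg (\prod_(l <- B1 ++ B2) l) = (deg (\prod_(l <- B1) l) * \prod_(l <- B2) c l)%N.
Proof.
move=> u1 s1 u2 a2.
have p1 : all prime B1 by apply/allP => l /s1; rewrite mem_primes => /and3P[].
have p2 : all prime B2 by apply: sub_all a2 => l /andP[].
rewrite big_cat /= degM ?prod_primes_gt0 ?gl2_card_prod //.
  move=> p pp d; have : p \in B1 by rewrite -mem_primes_prod // mem_primes pp prod_primes_gt0.
  by move/s1; rewrite mem_primes => /and3P[].
rewrite big_seq; apply: (big_ind (fun x => coprime x mE)) => [|x y|l lB].
- exact: coprime1n.
- by rewrite coprimeMl => -> ->.
by have /andP[pl nl] := allP a2 l lB; rewrite prime_coprime.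
Qed.

Lemma deg_rest l N : l \in rest N -> deg l = c l.
Proof.
rewrite mem_filter => /andP[pl _].
have := @deg_split_prod [::] [:: l] isT _ isT.
rewrite /= !big_seq1 big_nil deg1 mul1n andbT => h.
by apply: h => // k; rewrite in_nil.
Qed.

Lemma rN_uniq N : uniq (rN N).
Proof.
rewrite cat_uniq primes_uniq filter_uniq ?iota_uniq // andbT.
apply/hasPn => l; rewrite mem_filter mem_primes => /andP[/andP[_ nl] _].
by rewrite (negbTE nl) !andbF.
Qed.

Lemma rN_prime N : all prime (rN N).
Proof.
rewrite all_cat all_prime_primes; apply/allP => l.
by rewrite mem_filter => /andP[/andP[]].
Qed.

(** Each prime outside $m_E$ multiplies the degree by $|\mathrm{GL}_2(\mathbb{F}_\ell)|=\deg\ell$,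
    so the inner alternating sum is an Euler product and the outer one is the finite level. *)
Lemma altsum_rN N :
  altsum (rN N) (fun B => ((deg (\prod_(l <- B) l))%:R^-1 : rat))
  = (\prod_(l <- rN N) (1 - (deg l)%:R^-1)) * C.
Proof.
rewrite altsum_cat.
rewrite (eq_altsum (h := fun B1 => (\prod_(l <- rest N) (1 - (deg l)%:R^-1)) *
   (deg (\prod_(l <- B1) l))%:R^-1)); last first.
  move=> B1 sB1.
  rewrite (eq_altsum (h := fun B2 => (deg (\prod_(l <- B1) l))%:R^-1 *
     \prod_(l <- B2) (c l)%:R^-1)).
    rewrite altsumZ altsum_prod_mem mulrC; congr (_ * _).
    by rewrite big_seq [RHS]big_seq; apply: eq_bigr => l /deg_rest ->.
  move=> B2 sB2; rewrite deg_split_prod.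
  - by rewrite natrM invfM natr_prod -prodfV.
  - exact: subseq_uniq sB1 (primes_uniq _).
  - exact: mem_subseq.
  - by apply: subseq_uniq sB2 _; rewrite filter_uniq ?iota_uniq.
  - by apply/allP => l /(mem_subseq sB2); rewrite mem_filter => /andP[].
by rewrite altsumZ altC big_cat /= mulrA; congr (_ * _); rewrite mulrC.
Qed.

(** Once $N$ exceeds $m_E$, all primes of $m_E$ are below $N$, and listing them first only reorders
    the product. *)
Lemma prod_rN N : (mE < N)%N ->
  pN N = \prod_(l <- rN N) (1 - ((deg l)%:R : R)^-1).
Proof.
move=> mN; rewrite /pN -big_filter; apply: perm_big.
apply: uniq_perm; rewrite ?filter_uniq ?iota_uniq ?rN_uniq // => l.
rewrite mem_cat !mem_filter mem_primes mE_gt0 /= mem_index_iota leq0n /=.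
case: (prime l) => //=; case d: (l %| mE)%N => //=.
by rewrite (leq_ltn_trans (dvdn_leq mE_gt0 d) mN).
Qed.

Lemma sum_rN N : (mE < N)%N ->
  ratr C * pN N = \sum_(n <- [seq \prod_(l <- B) l | B <- sublists (rN N)]) f n.
Proof.
move=> mN; rewrite (prod_rN mN) mulrC.
have -> : \prod_(l <- rN N) (1 - ((deg l)%:R : R)^-1) =
    ratr (\prod_(l <- rN N) (1 - (deg l)%:R^-1)).
  rewrite rmorph_prod; apply: eq_bigr => l _.
  by rewrite rmorphB rmorph1 fmorphV rmorph_nat.
rewrite -rmorphM /= -altsum_rN altsum_rmorph altsum_sublists big_map.
rewrite big_seq [RHS]big_seq; apply: eq_bigr => B; rewrite mem_sublists => sB.
have uB := subseq_uniq sB (rN_uniq N).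
have pB : all prime B by apply/allP => l /(mem_subseq sB); apply: (allP (rN_prime N)).
rewrite /f moebius_prod // rmorphXn rmorphN rmorph1 fmorphV rmorph_nat //.
Qed.

Lemma prods_uniq N : uniq [seq (\prod_(l <- B) l)%N | B <- sublists (rN N)].
Proof.
rewrite map_inj_in_uniq ?sublists_uniq ?rN_uniq // => B1 B2.
rewrite !mem_sublists => s1 s2 e.
have u := rN_uniq N.
have p1 : all prime B1 by apply/allP => l /(mem_subseq s1); apply: (allP (rN_prime N)).
have p2 : all prime B2 by apply/allP => l /(mem_subseq s2); apply: (allP (rN_prime N)).
move/(subseq_uniqP u): (s1) => ->; move/(subseq_uniqP u): (s2) => ->.
apply: eq_filter => l.
by rewrite -(mem_primes_prod p1) -(mem_primes_prod p2) e.
Qed.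

Lemma mem_prods N n : (mE < N)%N -> (n < N)%N -> moebius n != 0 ->
  n \in [seq (\prod_(l <- B) l)%N | B <- sublists (rN N)].
Proof.
move=> mN nN /moebius_neq0[n0 en]; apply/mapP.
exists [seq l <- rN N | l \in primes n]; first by rewrite mem_sublists filter_subseq.
rewrite {1}en; apply: perm_big; apply: uniq_perm; rewrite ?filter_uniq ?rN_uniq ?primes_uniq //.
move=> l; rewrite mem_filter andb_idr // => ln.
have /and3P[pl _ dl] : [&& prime l, (0 < n)%N & (l %| n)%N] by rewrite -mem_primes.
rewrite mem_cat mem_filter mem_primes pl mE_gt0 mem_index_iota leq0n /=.
by case: (l %| mE)%N => //=; apply: leq_ltn_trans nN; apply: dvdn_leq.
Qed.

(** Split $n=n_1n_2$ with $n_1\mid m_E$ and $n_2$ prime to $m_E$: then $n_1\leq m_E$, while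
    $n_2^2\leq|\mathrm{GL}_2(\mathbb{Z}/n_2)|$ divides $\deg n$. *)
Lemma deg_lower n : moebius n != 0 -> (n ^ 2 <= mE ^ 2 * deg n)%N.
Proof.
case/moebius_neq0 => n0 en.
pose B1 := [seq l <- primes n | (l %| mE)%N].
pose B2 := [seq l <- primes n | ~~ (l %| mE)%N].
have e : n = (\prod_(l <- B1 ++ B2) l)%N.
  by rewrite {1}en; apply: perm_big; rewrite perm_sym /B1 /B2 perm_filterC.
have pr l : l \in primes n -> prime l by rewrite mem_primes => /and3P[].
have d1 : (\prod_(l <- B1) l %| mE)%N.
  apply: prod_primes_dvd; rewrite ?filter_uniq ?primes_uniq //.
    by apply/allP => l; rewrite mem_filter => /andP[_ /pr].
  by move=> l; rewrite mem_filter => /andP[].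
rewrite {2}e deg_split_prod ?filter_uniq ?primes_uniq //; last 2 first.
- by move=> l; rewrite mem_filter !mem_primes mE_gt0 => /andP[-> /and3P[->]].
- by apply/allP => l; rewrite mem_filter => /andP[-> /pr ->].
rewrite {1}e big_cat /= expnMn; apply: leq_mul; first by rewrite leq_exp2r // dvdn_leq.
have dB : (0 < deg (\prod_(l <- B1) l))%N by apply/deg_gt0/(dvdn_gt0 mE_gt0 d1).
apply: leq_trans (leq_pmull _ dB).
rewrite -mulnn -big_split /= big_seq [X in (_ <= X)%N]big_seq.
apply: (big_ind2 leq) => // [u u' v v'|l]; first exact: leq_mul.
by rewrite mem_filter mulnn => /andP[_ /pr /prime_gt1]; apply: gl2_prime_ge.
Qed.

Lemma norm_f n : `|f n| <= (mE ^ 2)%:R / (n ^ 2)%:R.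
Proof.
rewrite /f; have [->|nz] := eqVneq (moebius n) 0.
  by rewrite mul0r normr0 divr_ge0.
have [n0 _] := moebius_neq0 nz.
have dn : (0 : R) < (deg n)%:R by rewrite ltr0n deg_gt0.
have n2 : (0 : R) < (n ^ 2)%:R by rewrite ltr0n expn_gt0 n0.
have -> : `|(moebius n)%:~R / (deg n)%:R| = ((deg n)%:R : R)^-1.
  rewrite normrM normfV normr_nat; move: nz; rewrite /moebius; case: ifP => // _ _.
  by rewrite rmorphXn rmorphN rmorph1 normrX normrN1 expr1n mul1r.
rewrite ler_pdivlMr // mulrC ler_pdivrMr // -natrM ler_nat.
exact: deg_lower.
Qed.

Lemma sum_inv_sqr N M : (1 < N <= M)%N ->
  \sum_(N <= n < M) ((n ^ 2)%:R : R)^-1 <= ((N.-1)%:R)^-1 - ((M.-1)%:R)^-1.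
Proof.
case/andP=> N1; elim: M => [|M IHM]; first by rewrite leqn0 => /eqP N0; rewrite N0 in N1.
rewrite leq_eqVlt => /predU1P[<-|]; first by rewrite big_geq // subrr.
rewrite ltnS => NM; rewrite big_nat_recr //=.
apply: le_trans (lerD (IHM NM) (lexx _)) _.
have M1 : (1 < M)%N := leq_trans N1 NM.
have [k ->] : exists k, M = k.+2 by exists M.-2; case: (M) M1 => [|[]].
rewrite /= -addrA lerD2l.
rewrite -subr_ge0.
(* The telescoping step $\frac1{M^2}\leq\frac1{M-1}-\frac1M$ with its exact defect, for $M=k+2$. *)
have -> : - (k.+2%:R)^-1 - (- (k.+1%:R)^-1 + ((k.+2 ^ 2)%:R)^-1) = ((k.+1 * k.+2 ^ 2)%:R)^-1 :> R.
  have k1 : (k.+1%:R : R) != 0 by rewrite pnatr_eq0.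
  have k2 : (k.+2%:R : R) != 0 by rewrite pnatr_eq0.
  rewrite natrM natrX; move: k1 k2; rewrite -(natr1 k.+1).
  by move: (k.+1%:R : R) => x k1 k2; field; rewrite k1 k2.
by rewrite invr_ge0.
Qed.

(** The expanded product runs over square-free numbers, among them all those below $N$; the excess
    consists of terms with $n\geq N$ and is bounded by the tail of $\sum m_E^2/n^2$. *)
Lemma sum_f_prods N : (mE < N)%N -> (1 < N)%N ->
  `| \sum_(1 <= n < N) f n - ratr C * pN N | <= (mE ^ 2)%:R / (N.-1)%:R.
Proof.
move=> mN N1; rewrite (sum_rN mN).
set D := [seq _ | B <- _].
(* Any bound beyond $N$ and all of [D] would do; the tail estimate does not depend on it. *)
pose M := (N + \max_(n <- D) n.+1)%N.
have DM n : n \in D -> (0 < n < M)%N.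
  move=> nD; apply/andP; split.
    case/mapP: nD => B; rewrite mem_sublists => sB ->; apply: prod_primes_gt0.
    by apply/allP => l /(mem_subseq sB); apply: (allP (rN_prime N)).
  apply: leq_trans (leq_addl _ _).
  by rewrite (big_rem n) //= leq_maxl.
have -> : \sum_(n <- D) f n = \sum_(1 <= n < M | n \in D) f n.
  rewrite -[RHS]big_filter; apply: perm_big; apply: uniq_perm.
  - exact: prods_uniq.
  - by rewrite filter_uniq ?iota_uniq.
  move=> n; rewrite mem_filter mem_index_iota; apply/idP/idP => [nD|/andP[]//].
  by rewrite nD DM.
have NM : (N <= M)%N by apply: leq_addr.
have -> : \sum_(1 <= n < M | n \in D) f n =
    \sum_(1 <= n < N | n \in D) f n + \sum_(N <= n < M | n \in D) f n.
  by rewrite -big_cat_nat // ltnW.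
have -> : \sum_(1 <= n < N | n \in D) f n = \sum_(1 <= n < N) f n.
  rewrite big_mkcond big_nat [RHS]big_nat; apply: eq_bigr => n /andP[_ nN].
  case: ifP => // nD; rewrite /f; have [->|nz] := eqVneq (moebius n) 0.
    by rewrite mul0r.
  by move: nD; rewrite mem_prods.
rewrite opprD addrA subrr sub0r normrN.
apply: le_trans (ler_norm_sum _ _ _) _.
apply: (@le_trans _ _ (\sum_(N <= n < M) (mE ^ 2)%:R / (n ^ 2)%:R)).
  rewrite big_mkcond; apply: ler_sum => n _; case: ifP => _; first exact: norm_f.
  by rewrite divr_ge0.
rewrite -mulr_sumr ler_wpM2l //.
apply: le_trans (sum_inv_sqr _) _; first by rewrite N1 NM.
by rewrite gerBl invr_ge0.
Qed.

Lemma factor_bounds l : prime l -> 0 <= 1 - ((deg l)%:R : R)^-1 <= 1.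
Proof.
move=> pl; have d0 : (0 < deg l)%N by apply/deg_gt0/prime_gt0.
by rewrite subr_ge0 gerBl invr_ge0 ler0n andbT invf_le1 ?ltr0n // ler1n.
Qed.

Lemma pN_ge0 N : 0 <= pN N.
Proof. by apply: prodr_ge0 => l /factor_bounds/andP[]. Qed.

Lemma pN_cvg : exists L : R, (pN @ \oo --> L).
Proof.
exists (limn pN); apply: nonincreasing_is_cvgn.
  apply/nonincreasing_seqP => N; rewrite /pN big_mkcond [X in _ <= X]big_mkcond big_nat_recr //=.
  rewrite -!(big_mkcond (fun l => prime l)) -/(pN N).
  case: ifP => [pl|_]; last by rewrite mulr1.
  have /andP[h0 h1] := factor_bounds pl.
  by rewrite ler_piMr // pN_ge0.
by exists 0 => _ [N _ <-]; apply: pN_ge0.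
Qed.

Lemma euler_product_cvg : exists L : R,
  (pN @ \oo --> L) /\
  ((fun N => \sum_(1 <= n < N) f n) @ \oo --> ratr C * L).
Proof.
have [L pL] := pN_cvg; exists L; split=> //.
(* [harmonic N] is $1/(N+1)$, and the factor 2 absorbs the shift: $\frac1{N-1}\leq\frac2{N+1}$ for
   $N\geq3$. *)
pose ep (N : nat) : R := (2 * mE ^ 2)%:R * harmonic N.
have ep0 : (ep @ \oo --> (0 : R)).
  have := @cvgMl_tmp _ _ _ _ _ ((2 * mE ^ 2)%:R : R) _ (@cvg_harmonic R).
  by rewrite mulr0; apply.
have cL : ((fun N => ratr C * pN N) @ \oo --> ratr C * L) by apply: cvgMl_tmp.
have lo : ((fun N => ratr C * pN N - ep N) @ \oo --> ratr C * L).
  by have := cvgB cL ep0; rewrite subr0; apply.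
have hi : ((fun N => ratr C * pN N + ep N) @ \oo --> ratr C * L).
  by have := cvgD cL ep0; rewrite addr0; apply.
apply: squeeze_cvgr lo hi.
near=> N.
have mN : (mE < N)%N by near: N; exists mE.+1.
have N2 : (2 < N)%N by near: N; exists 3%N.
have := sum_f_prods mN (ltnW N2).
have : (mE ^ 2)%:R / (N.-1)%:R <= ep N.
  rewrite /ep /harmonic /= mulnC natrM -mulrA ler_wpM2l //.
  have -> : N = (N - 3).+3 by rewrite -addn3 subnK.
  move: (N - 3)%N => k.
  rewrite /= -[X in X^-1 <= _]/(k.+2%:R) ler_pdivlMr ?ltr0n // mulrC ler_pdivrMr ?ltr0n //.
  by rewrite -natrM ler_nat mulnC muln2 -addnn; lia.
move=> e1 e2; have := le_trans e2 e1; rewrite ler_norml => /andP[h1 h2].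
by rewrite lerBlDr -lerBlDl -opprB lerNl h1 /= addrC -lerBlDr.
Unshelve. all: by end_near. Qed.

End EulerProduct.

Lemma field_deg_QE1 a b d : field_deg (QE a b 1) d -> d = 1%N.
Proof.
move=> h; have d_gt0 := field_deg_gt0 h.
have [s [_ dist _]] := field_deg_gal_card h.
apply/eqP; rewrite eqn_leq d_gt0 andbT leqNgt; apply/negP => d1.
have [//|R [/andP[_ /eqP]]] := dist 0%N 1%N d_gt0 d1.
by rewrite /= paddP0 => ->.
Qed.

Theorem theorem4p2 (R : realType) (a b : rat) (mE : nat) (P Q : point)
    (deg : nat -> nat) :
  nonsingular a b ->
  ~ has_CM a b ->
  is_mE a b mE ->
  abelian_entanglements a b mE ->
  tors_basis a b (sqf_rad mE) P Q ->
  (forall n, (0 < n)%N -> field_deg (QE a b n) (deg n)) ->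
  exists L : R,
    (fun N : nat => \prod_(0 <= l < N | prime l) (1 - ((deg l)%:R : R)^-1))
      @ \oo --> L /\
    (fun N : nat => \sum_(1 <= n < N) (moebius n)%:~R / ((deg n)%:R : R))
      @ \oo --> ratr (frakC a (sqf_rad mE) P Q deg) * L.
Proof.
move=> ns _ [mE_gt0 splitE _ _] ent PQ degE.
have deg1 : deg 1 = 1%N := field_deg_QE1 (degE 1%N isT).
apply: (@euler_product_cvg R deg mE) => //.
- by move=> n /degE/field_deg_gt0.
- move=> n1 n2 n1_gt0 n2_gt0 pn1 con2.
  apply: (splitE n1 n2) => //; apply: field_deg_gal_card; apply: degE => //.
  by rewrite muln_gt0 n1_gt0.
have [m_gt1|m_le1] := ltnP 1 (sqf_rad mE).
  by have := altsum_deg_frakC ns m_gt1 ent PQ degE; rewrite primes_sqf_rad.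
(* The matrix description needs $m>1$, since ['Z_1] is by convention $\mathbb{Z}/2$. For $m=1$ there
   are no primes and both sides equal 1. *)
have m1 : sqf_rad mE = 1%N by apply/eqP; rewrite eqn_leq m_le1 sqf_rad_gt0.
by rewrite -primes_sqf_rad m1 /frakC /= !big_nil deg1 mulr1 invr1.
Qed.
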